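(* There are constants $C,c>0$, independent of $N$ and $k$, such that for all $N\ge2$, all $k\in\{1,\ldots,N-1\}$ with $\bar x=(k-\tfrac12)p\ell^2/R$, and all $n\in\mathbb{N}_0$, $$P_N\bigl(|K(\bar x;z_1,\ldots,z_N)|\ge n\bigr)\le C\exp(-cn^3).$$
   Context: Setting. Let $R,\ell>0$ and $p\in\mathbb{N}$. $\mathcal{Z}=\mathbb{R}\times[0,2\pi R]$, with $z=x+iy$. Laughlin's function. $$\Psi_N(z_1,\ldots,z_N)=\kappa_N\prod_{j<k}\bigl(e^{z_k/R}-e^{z_j/R}\bigr)^p\exp\Bigl(-\frac{1}{2\ell^2}\sum_k x_k^2\Bigr),$$ with $\kappa_N>0$. Probability measure. $P_N$ is the probability measure on $\mathcal{Z}^N$ with density proportional to $|\Psi_N|^2$. Particle excess function. For $\bar x=(k-\tfrac12)p\ell^2/R$, $$K(\bar x;z_1,\ldots,z_N)=\#\{j:x_j\le\bar x\}-k .$$ *)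

(* Defs.v *)
From HB Require Import structures.
From mathcomp Require Import all_boot all_order all_algebra.
From mathcomp Require Import all_classical all_reals all_analysis.
Set Implicit Arguments. Unset Strict Implicit. Unset Printing Implicit Defensive.
Import Order.TTheory GRing.Theory Num.Theory.
Import numFieldNormedType.Exports.
Local Open Scope classical_set_scope.
Local Open Scope ring_scope.

Section Laughlin.
Variable R : realType.

(* A point z = x + i y of the cylinder Z = R x [0, 2 pi Rad] is the pair (x, y).
   A configuration (z_1, ..., z_N) is a sequence of N such pairs. *)

Fixpoint cyl_int (Rad : R) (n : nat) (f : seq (R * R) -> \bar R) : \bar R :=
  match n with
  | 0 => f [::]
  | n'.+1 =>
      (\int[lebesgue_measure]_(x in [set: R])
        \int[lebesgue_measure]_(y in [set y : R | (0 <= y <= 2 * pi * Rad)%R])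
          cyl_int Rad n' (fun v => f ((x, y) :: v)))%E
  end.

Definition ez_re (Rad : R) (z : R * R) : R := expR (z.1 / Rad) * cos (z.2 / Rad).
Definition ez_im (Rad : R) (z : R * R) : R := expR (z.1 / Rad) * sin (z.2 / Rad).

Definition sqmod_diff (Rad : R) (zj zk : R * R) : R :=
  (ez_re Rad zk - ez_re Rad zj) ^+ 2 + (ez_im Rad zk - ez_im Rad zj) ^+ 2.

(* |Psi_N(z)|^2 / kappa_N^2  (the normalization constant cancels in P_N) *)
Definition laughlin_sq (Rad ell : R) (p : nat) (z : seq (R * R)) : R :=
  (\prod_(j < size z) \prod_(k < size z | (j < k)%N)
      sqmod_diff Rad (nth (0, 0) z j) (nth (0, 0) z k) ^+ p)
  * expR (- (\sum_(j < size z) (nth (0, 0) z j).1 ^+ 2) / ell ^+ 2).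

Definition PN (Rad ell : R) (p N : nat) (E : seq (R * R) -> bool) : R :=
  fine (cyl_int Rad N (fun z => ((E z)%:R * laughlin_sq Rad ell p z)%:E))
  / fine (cyl_int Rad N (fun z => (laughlin_sq Rad ell p z)%:E)).

Definition xbar (Rad ell : R) (p k : nat) : R :=
  (k%:R - 2^-1) * p%:R * ell ^+ 2 / Rad.

Definition Kexcess (xb : R) (k : nat) (z : seq (R * R)) : int :=
  (count (fun w : R * R => w.1 <= xb) z)%:Z - k%:Z.

End Laughlin.

(* Main.v *)
(** Sites [t_j = (j - 1/2) a], [a = p ell^2 / Rad], cut the cylinder into cells, cell [c]
surrounding [c a].  A particle with [L] others on its left sees, up to short-range terms,
the harmonic well [(x - L a)^2 / ell^2].  If the excess at [t_k] is [t > 0], the last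
particle left of [t_k] has [L = k + t - 1], hence sits at distance at least [(t - 1/2) a]
from its well; moving it to [L a] gains a factor [exp(- rate t^2)] and lowers the excess by
one.  (If the excess is [- t], move the first particle right of [t_k].)

Two things control the short-range terms.  At the new position the angle is averaged:
[|w - w_i|^2 = max(|w|, |w_i|)^2 |1 - b_i e^{iy/Rad}|^2], and a polynomial with constant term
1 has quadratic mean at least 1 on the circle (Landau).  At the old position they cost the
exponential of the number of particles nearby, which is linear in [s] and in the distance to
[k] as long as the excess at every site [i] is at most [s + |i - k|] in absolute value.  Such
a [k] is found by maximising the excess minus the distance to the given site, and a move
raises [s] by one only.  After [t] moves the gain is [exp(- rate t^3 / 3)] against a loss
[exp(O(t^2))]; a union bound over the maximising sites concludes. *)

Require Import Defs.
From HB Require Import structures.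
From mathcomp Require Import all_boot all_order all_algebra.
From mathcomp Require Import all_classical all_reals all_analysis.
From mathcomp Require Import measurable_realfun ring lra zify.
Import Order.TTheory GRing.Theory Num.Theory.
Import numFieldNormedType.Exports.
Local Open Scope classical_set_scope.
Local Open Scope ring_scope.
Set Implicit Arguments. Unset Strict Implicit. Unset Printing Implicit Defensive.

(** * Iterated integrals over the cylinder *)

Section SetTonelli.
Context d1 d2 (T1 : measurableType d1) (T2 : measurableType d2) (R : realType).
Variables (m1 : {sigma_finite_measure set T1 -> \bar R}).
Variables (m2 : {sigma_finite_measure set T2 -> \bar R}).
Variables (D1 : set T1) (D2 : set T2).
Hypotheses (mD1 : measurable D1) (mD2 : measurable D2).
Variable G : T1 * T2 -> \bar R.
Hypotheses (mG : measurable_fun setT G) (G0 : forall w, (0 <= G w)%E).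
(** Extension by zero turns both iterated integrals over the rectangle into integrals over whole
    spaces, where Tonelli applies. *)
Let H := G \_ (D1 `*` D2).

Let mH : measurable_fun setT H.
Proof.
apply/(measurable_restrictT _ _).1; first exact: measurableX.
exact: measurable_funTS.
Qed.

Let H0 w : (0 <= H w)%E. Proof. exact: erestrict_ge0. Qed.

Let HE : (fun x => \int[m2]_y H (x, y))%E = (fun x => \int[m2]_(y in D2) G (x, y))%E \_ D1.
Proof.
apply/funext => x; rewrite patchE; case: ifPn => xD.
  by rewrite [RHS]integral_mkcond; apply: eq_integral => y _; rewrite /H !patchE in_setX xD.
by rewrite integral0_eq// => y _; rewrite /H patchE in_setX (negbTE xD).
Qed.

Let HE' : (fun y => \int[m1]_x H (x, y))%E = (fun y => \int[m1]_(x in D1) G (x, y))%E \_ D2.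
Proof.
apply/funext => x; rewrite patchE; case: ifPn => xD.
  by rewrite [RHS]integral_mkcond; apply: eq_integral => y _; rewrite /H !patchE in_setX xD andbT.
by rewrite integral0_eq// => y _; rewrite /H patchE in_setX (negbTE xD) andbF.
Qed.

Lemma integral_setX_tonelli :
  (\int[m1]_(x in D1) \int[m2]_(y in D2) G (x, y) =
   \int[(m1 \x m2)%E]_(w in D1 `*` D2) G w)%E.
Proof.
rewrite [LHS]integral_mkcond -HE [RHS]integral_mkcond.
by rewrite (@fubini_tonelli1 _ _ _ _ _ m1 m2 H mH H0).
Qed.

Lemma integral_swap_tonelli :
  (\int[m1]_(x in D1) \int[m2]_(y in D2) G (x, y) =
   \int[m2]_(y in D2) \int[m1]_(x in D1) G (x, y))%E.
Proof.
rewrite [LHS]integral_mkcond -HE [RHS]integral_mkcond -HE'.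
exact: (@fubini_tonelli _ _ _ _ _ m1 m2 H mH H0).
Qed.

End SetTonelli.

Lemma measurable_integral_param d1 d2 (T1 : measurableType d1) (T2 : measurableType d2)
    (R : realType) (m2 : {sigma_finite_measure set T2 -> \bar R}) (D2 : set T2)
    (G : T1 * T2 -> \bar R) :
  measurable D2 -> measurable_fun setT G -> (forall w, (0 <= G w)%E) ->
  measurable_fun setT (fun x => \int[m2]_(y in D2) G (x, y))%E.
Proof.
move=> mD2 mG G0.
have mS : measurable ([set: T1] `*` D2) by exact: measurableX.
rewrite (_ : (fun t => _) = fubini_F m2 (G \_ ([set: T1] `*` D2))).
  apply: (@measurable_fun_fubini_tonelli_F _ _ _ _ _ m2).
  - by apply/(measurable_restrictT _ _).1 => //; exact: measurable_funTS.
  - by move=> z; apply: erestrict_ge0.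
apply/funext => t; rewrite /fubini_F [LHS]integral_mkcond.
by apply: eq_integral => z _; rewrite !patchE in_setX in_setT.
Qed.

Definition rem_at (T : Type) j (v : seq T) := take j v ++ drop j.+1 v.

Section CylinderIntegral.
Variables (R : realType) (Rad : R).
Local Notation RM := (measurableTypeR R).
Local Notation Z := (RM * RM)%type.
Local Notation mu := (@lebesgue_measure R).

Definition angles : set RM := [set y : R | (0 <= y <= 2 * pi * Rad)%R].

(** Kept as an iterated integral so that [cyl_int] unfolds to it by computation ([cyl_intS]);
    [zintE] gives the product-measure form. *)
Definition zint (g : R * R -> \bar R) : \bar R :=
  (\int[mu]_x \int[mu]_(y in angles) g (x, y))%E.

Definition strip : set Z := setT `*` angles.

Lemma measurable_angles : measurable angles.
Proof.
rewrite (_ : angles = [set` `[0, 2 * pi * Rad]]); first exact: measurable_itv.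
by apply/seteqP; split => y; rewrite /= in_itv.
Qed.

Lemma measurable_strip : measurable strip.
Proof. by apply: measurableX => //; exact: measurable_angles. Qed.

Lemma zintE (g : Z -> \bar R) : measurable_fun setT g -> (forall z, 0 <= g z)%E ->
  zint g = (\int[mu \x mu]_(z in strip) g z)%E.
Proof. exact: (integral_setX_tonelli mu mu measurableT measurable_angles). Qed.

Lemma zint_ge0 g : (forall z, 0 <= g z)%E -> (0 <= zint g)%E.
Proof. by move=> g0; apply: integral_ge0 => x _; apply: integral_ge0. Qed.

Lemma eq_zint g h : g =1 h -> zint g = zint h.
Proof. by move=> gh; congr zint; apply/funext. Qed.

Lemma le_zint (g h : Z -> \bar R) : measurable_fun setT g -> measurable_fun setT h ->
  (forall z, 0 <= g z)%E -> (forall z, g z <= h z)%E -> (zint g <= zint h)%E.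
Proof.
move=> mg mh g0 gh.
have h0 z : (0 <= h z)%E by exact: le_trans (gh z).
rewrite !zintE//; apply: ge0_le_integral => //.
- exact: measurable_strip.
- exact: measurable_funTS.
- exact: measurable_funTS.
Qed.

Lemma zintD (g h : Z -> \bar R) : measurable_fun setT g -> measurable_fun setT h ->
  (forall z, 0 <= g z)%E -> (forall z, 0 <= h z)%E ->
  (zint (fun z => g z + h z) = zint g + zint h)%E.
Proof.
move=> mg mh g0 h0; rewrite !zintE//.
- apply: ge0_integralD => //; [exact: measurable_strip|exact: measurable_funTS..].
- exact: emeasurable_funD.
- by move=> z; exact: adde_ge0.
Qed.

Lemma zintZ (c : R) (g : Z -> \bar R) : measurable_fun setT g ->
  (forall z, 0 <= g z)%E -> 0 <= c ->
  (zint (fun z => c%:E * g z) = c%:E * zint g)%E.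
Proof.
move=> mg g0 c0; rewrite !zintE//.
- apply: ge0_integralZl => //; [exact: measurable_strip|exact: measurable_funTS].
- exact: measurable_funeM.
- by move=> z; rewrite mule_ge0.
Qed.

Lemma measurable_zint d (T : measurableType d) (G : T * Z -> \bar R) :
  measurable_fun setT G -> (forall w, 0 <= G w)%E ->
  measurable_fun setT (fun t => zint (fun z => G (t, z))).
Proof.
move=> mG G0.
apply: (@measurable_integral_param _ _ T RM R mu setT
          (fun w => \int[mu]_(y in angles) G (w.1, (w.2, y)))%E) => //; last first.
  by move=> w; exact: integral_ge0.
apply: (@measurable_integral_param _ _ (T * RM)%type RM R mu angles
          (fun w => G (w.1.1, (w.1.2, w.2)))) => //.
  exact: measurable_angles.
apply: (measurableT_comp mG).
apply: measurable_fun_pair; first exact: (measurableT_comp measurable_fst measurable_fst).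
apply: measurable_fun_pair; first exact: (measurableT_comp measurable_snd measurable_fst).
exact: measurable_snd.
Qed.

Lemma zint_integral_swap (D : set RM) (H : Z * RM -> \bar R) : measurable D ->
  measurable_fun setT H -> (forall w, 0 <= H w)%E ->
  zint (fun z => \int[mu]_(t in D) H (z, t))%E =
  (\int[mu]_(t in D) zint (fun z => H (z, t)))%E.
Proof.
move=> mD mH H0.
rewrite /zint -(@integral_swap_tonelli _ _ RM RM R mu mu setT D measurableT mD
  (fun w => \int[mu]_(y in angles) H ((w.1, y), w.2))%E); last 2 first.
- apply: (@measurable_integral_param _ _ (RM * RM)%type RM R mu angles
            (fun w => H ((w.1.1, w.2), w.1.2))) => //.
    exact: measurable_angles.
  apply: (measurableT_comp mH).
  apply: measurable_fun_pair; last exact: (measurableT_comp measurable_snd measurable_fst).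
  apply: measurable_fun_pair; first exact: (measurableT_comp measurable_fst measurable_fst).
  exact: measurable_snd.
- by move=> w; exact: integral_ge0.
apply: eq_integral => x _.
apply: (@integral_swap_tonelli _ _ RM RM R mu mu angles D measurable_angles mD
  (fun w => H ((x, w.1), w.2))) => //.
apply: (measurableT_comp mH).
apply: measurable_fun_pair; last exact: measurable_snd.
by apply: measurable_fun_pair; [exact: measurable_cst|exact: measurable_fst].
Qed.

(** The integral over [z] is moved as a whole, first past the abscissa of [z'], then past its
    angle. *)
Lemma zint_swap (G : Z * Z -> \bar R) :
  measurable_fun setT G -> (forall w, 0 <= G w)%E ->
  zint (fun z => zint (fun z' => G (z, z'))) = zint (fun z' => zint (fun z => G (z, z'))).
Proof.
move=> mG G0.
pose F (w : Z * RM) := (\int[mu]_(y in angles) G (w.1, (w.2, y)))%E.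
have mF : measurable_fun setT F.
  apply: (@measurable_integral_param _ _ (Z * RM)%type RM R mu angles
            (fun w => G (w.1.1, (w.1.2, w.2)))) => //.
    exact: measurable_angles.
  apply: (measurableT_comp mG).
  apply: measurable_fun_pair; first exact: (measurableT_comp measurable_fst measurable_fst).
  apply: measurable_fun_pair; first exact: (measurableT_comp measurable_snd measurable_fst).
  exact: measurable_snd.
have F0 w : (0 <= F w)%E by exact: integral_ge0.
transitivity (\int[mu]_x zint (fun z => F (z, x)))%E.
  exact: (zint_integral_swap measurableT mF F0).
apply: eq_integral => x _.
apply: (@zint_integral_swap angles (fun w => G (w.1, (x, w.2)))) => //.
  exact: measurable_angles.
apply: (measurableT_comp mG).
apply: measurable_fun_pair; first exact: measurable_fst.
by apply: measurable_fun_pair; [exact: measurable_cst|exact: measurable_snd].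
Qed.

Definition measurable_coords d (T : measurableType d) (xs : seq (T -> Z)) :=
  forall i, measurable_fun setT (nth (cst (0, 0)) xs i).

(* A function of configurations of size [n] has no ambient measurable type: its
   measurability is tested along all measurable choices of the [n] points. *)
Definition cfg_measurable (n : nat) (F : seq (R * R) -> \bar R) :=
  forall d (T : measurableType d) (xs : seq (T -> Z)),
    size xs = n -> measurable_coords xs ->
    measurable_fun setT (fun t => F [seq x t | x <- xs]).

Lemma measurable_coords_cons d (T : measurableType d) x (xs : seq (T -> Z)) :
  measurable_fun setT x -> measurable_coords xs -> measurable_coords (x :: xs).
Proof. by move=> mx mxs [|i] /=. Qed.

Lemma measurable_coords_consP d (T : measurableType d) x (xs : seq (T -> Z)) :
  measurable_coords (x :: xs) -> measurable_fun setT x /\ measurable_coords xs.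
Proof. by move=> m; split; [exact: (m 0%N)|move=> i; exact: (m i.+1)]. Qed.

Lemma measurable_coords_comp d d' (T : measurableType d) (T' : measurableType d')
    (h : T' -> T) (xs : seq (T -> Z)) : measurable_fun setT h ->
  measurable_coords xs -> measurable_coords [seq x \o h | x <- xs].
Proof.
move=> mh mxs i; have [ix|ix] := ltnP i (size xs).
  by rewrite (nth_map (cst (0, 0)))//; exact: measurableT_comp.
by rewrite nth_default ?size_map//; exact: measurable_cst.
Qed.

Lemma measurable_coords_rcons d (T : measurableType d) x (xs : seq (T -> Z)) :
  measurable_fun setT x -> measurable_coords xs -> measurable_coords (rcons xs x).
Proof. by move=> mx mxs i; rewrite nth_rcons; do 2 case: ifP => //. Qed.

Lemma cfg_measurable_cons n F z :
  cfg_measurable n.+1 F -> cfg_measurable n (fun v => F (z :: v)).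
Proof.
move=> mF d T xs sx mxs.
by apply: (mF _ _ (cst z :: xs)); [rewrite /= sx|exact: measurable_coords_cons].
Qed.

Lemma cyl_int_ge0 n F : (forall v, 0 <= F v)%E -> (0 <= cyl_int Rad n F)%E.
Proof.
elim: n F => [|n IH] F F0 //=.
by apply: integral_ge0 => x _; apply: integral_ge0 => y _; exact: IH.
Qed.

Lemma cyl_intS n F :
  cyl_int Rad n.+1 F = zint (fun z => cyl_int Rad n (fun v => F (z :: v))).
Proof. by []. Qed.

(** The first [m] points depend on a parameter because each integration frees one more point: the
    induction passes from [T] to [T * Z], the new point being appended to [xs]. *)
Lemma measurable_cyl_int d (T : measurableType d) n m F (xs : seq (T -> Z)) :
  cfg_measurable (m + n) F -> (forall v, 0 <= F v)%E ->
  size xs = m -> measurable_coords xs ->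
  measurable_fun setT (fun t => cyl_int Rad n (fun v => F ([seq x t | x <- xs] ++ v))).
Proof.
elim: n m d T xs => [|n IH] m d T xs mF F0 sx mxs.
  under eq_fun do rewrite /= cats0.
  by apply: mF => //; rewrite addn0.
pose ys : seq (T * Z -> Z) := rcons [seq x \o fst | x <- xs] snd.
pose G (w : T * Z) := cyl_int Rad n (fun v => F ([seq y w | y <- ys] ++ v)).
have mG : measurable_fun setT G.
  apply: (IH m.+1); rewrite ?addSn -?addnS ?size_rcons ?size_map ?sx//.
  apply: measurable_coords_rcons; first exact: measurable_snd.
  by apply: measurable_coords_comp => //; exact: measurable_fst.
have G0 w : (0 <= G w)%E by exact: cyl_int_ge0.
rewrite (_ : (fun t => _) = fun t => zint (fun z => G (t, z))).
  exact: measurable_zint.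
apply/funext => t; rewrite cyl_intS; apply: eq_zint => z.
rewrite /G; congr (cyl_int Rad n _); apply/funext => v.
by rewrite /ys map_rcons cat_rcons -map_comp.
Qed.

Lemma eq_cyl_int n F G : (forall v, size v = n -> F v = G v) ->
  cyl_int Rad n F = cyl_int Rad n G.
Proof.
elim: n F G => [|n IH] F G FG /=; first exact: FG.
apply: eq_integral => x _; apply: eq_integral => y _.
by apply: IH => v sv; apply: FG; rewrite /= sv.
Qed.

Lemma measurable_cyl_int_cons n F : cfg_measurable n.+1 F -> (forall v, 0 <= F v)%E ->
  measurable_fun setT (fun z : Z => cyl_int Rad n (fun v => F (z :: v))).
Proof.
move=> mF F0.
apply: (@measurable_cyl_int _ _ n 1 F [:: id]) => //.
by apply: measurable_coords_cons; [exact: measurable_id|move=> i; rewrite nth_nil; exact: measurable_cst].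
Qed.

Lemma le_cyl_int n F G : cfg_measurable n F -> cfg_measurable n G ->
  (forall v, 0 <= F v)%E -> (forall v, 0 <= G v)%E ->
  (forall v, size v = n -> F v <= G v)%E -> (cyl_int Rad n F <= cyl_int Rad n G)%E.
Proof.
elim: n F G => [|n IH] F G mF mG F0 G0 FG; first exact: FG.
rewrite !cyl_intS; apply: le_zint => [||z|z].
- exact: measurable_cyl_int_cons.
- exact: measurable_cyl_int_cons.
- exact: cyl_int_ge0.
- apply: IH => [||//|//|v sv]; [exact: cfg_measurable_cons..|by apply: FG; rewrite /= sv].
Qed.

Lemma cfg_measurableZ n (c : R) F : cfg_measurable n F ->
  cfg_measurable n (fun v => c%:E * F v)%E.
Proof. by move=> mF d T xs sx mxs; apply: measurable_funeM; exact: mF. Qed.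

Lemma cfg_measurable_sum n I (r : seq I) (F : I -> seq (R * R) -> \bar R) :
  (forall i, cfg_measurable n (F i)) -> cfg_measurable n (fun v => \sum_(i <- r) F i v)%E.
Proof.
move=> mF d T xs sx mxs; apply: emeasurable_sum => i.
exact: mF.
Qed.

Lemma cyl_intD n F G : cfg_measurable n F -> cfg_measurable n G ->
  (forall v, 0 <= F v)%E -> (forall v, 0 <= G v)%E ->
  (cyl_int Rad n (fun v => F v + G v) = cyl_int Rad n F + cyl_int Rad n G)%E.
Proof.
elim: n F G => [//|n IH] F G mF mG F0 G0.
rewrite !cyl_intS -zintD.
- by apply: eq_zint => z; apply: IH => //; exact: cfg_measurable_cons.
- exact: measurable_cyl_int_cons.
- exact: measurable_cyl_int_cons.
- by move=> z; exact: cyl_int_ge0.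
- by move=> z; exact: cyl_int_ge0.
Qed.

Lemma cyl_intZ n (c : R) F : cfg_measurable n F -> (forall v, 0 <= F v)%E -> 0 <= c ->
  (cyl_int Rad n (fun v => c%:E * F v) = c%:E * cyl_int Rad n F)%E.
Proof.
elim: n F => [//|n IH] F mF F0 c0.
transitivity (zint (fun z => c%:E * cyl_int Rad n (fun v => F (z :: v)))%E).
  rewrite cyl_intS; apply: eq_zint => z.
  by apply: IH => //; exact: cfg_measurable_cons.
apply: zintZ => //.
- exact: measurable_cyl_int_cons.
- by move=> z; exact: cyl_int_ge0.
Qed.

Lemma cyl_int_sum n I (r : seq I) (F : I -> seq (R * R) -> \bar R) :
  (forall i, cfg_measurable n (F i)) -> (forall i v, 0 <= F i v)%E ->
  (cyl_int Rad n (fun v => \sum_(i <- r) F i v) = \sum_(i <- r) cyl_int Rad n (F i))%E.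
Proof.
move=> mF F0; elim: r => [|i r IH].
  rewrite big_nil; under eq_fun do rewrite big_nil.
  elim: n {mF} => //= n IHn; rewrite IHn.
  by under eq_integral do rewrite integral0; rewrite integral0.
under eq_fun do rewrite big_cons; rewrite big_cons cyl_intD ?IH//.
- exact: cfg_measurable_sum.
- by move=> v; apply: sume_ge0.
Qed.

Lemma cyl_int_zint_swap n (phi : R * R -> seq (R * R) -> \bar R) :
  cfg_measurable n.+1 (fun w => phi (head (0, 0) w) (behead w)) ->
  (forall z v, 0 <= phi z v)%E ->
  zint (fun z => cyl_int Rad n (phi z)) = cyl_int Rad n (fun v => zint (phi^~ v)).
Proof.
elim: n phi => [//|n IH] phi mphi phi0.
under eq_zint do rewrite cyl_intS.
rewrite cyl_intS.
rewrite (@zint_swap (fun w => cyl_int Rad n (fun v => phi w.1 (w.2 :: v)))).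
- apply: eq_zint => z; apply: (IH (fun z' v => phi z' (z :: v))) => // d T xs sx mxs.
  case: xs sx mxs => //= x xs [sx] /measurable_coords_consP[mx mxs].
  apply: (mphi _ _ [:: x, cst z & xs]); first by rewrite /= sx.
  by do 2 apply: measurable_coords_cons => //.
- have := @measurable_cyl_int _ (Z * Z)%type n 2 _ [:: fst; snd] mphi.
  apply => //.
  apply: measurable_coords_cons; first exact: measurable_fst.
  apply: measurable_coords_cons; first exact: measurable_snd.
  by move=> i; rewrite nth_nil; exact: measurable_cst.
- by move=> w; exact: cyl_int_ge0.
Qed.

(** Tonelli makes the integral over the [j]-th point the innermost one, so that any particle can be
    moved while the others stay frozen. *)
Lemma cyl_int_insert n j (phi : R * R -> seq (R * R) -> \bar R) : (j <= n)%N ->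
  cfg_measurable n.+1 (fun w => phi (head (0, 0) w) (behead w)) ->
  (forall z v, 0 <= phi z v)%E ->
  cyl_int Rad n.+1 (fun w => phi (nth (0, 0) w j) (rem_at j w)) =
  cyl_int Rad n (fun v => zint (phi^~ v)).
Proof.
elim: j n phi => [|j IH] n phi jn mphi phi0.
  rewrite -(cyl_int_zint_swap mphi phi0) cyl_intS; apply: eq_zint => z.
  by apply: eq_cyl_int => v _; rewrite /rem_at /= drop0.
case: n jn mphi => [|n] jn mphi; first by exfalso.
apply: etrans (cyl_intS _ _) _; apply: etrans _ (esym (cyl_intS _ _)).
apply: eq_zint => z; apply: (IH n (fun z' v => phi z' (z :: v))) => // d T xs sx mxs.
case: xs sx mxs => //= x xs [sx] /measurable_coords_consP[mx mxs].
apply: (mphi _ _ [:: x, cst z & xs]); first by rewrite /= sx.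
by do 2 apply: measurable_coords_cons => //.
Qed.

Lemma cfg_measurable_zint n (phi : R * R -> seq (R * R) -> \bar R) :
  cfg_measurable n.+1 (fun w => phi (head (0, 0) w) (behead w)) ->
  (forall z v, 0 <= phi z v)%E ->
  cfg_measurable n (fun v => zint (phi^~ v)).
Proof.
move=> mphi phi0 d T xs sx mxs.
apply: (@measurable_zint _ T (fun w => phi w.2 [seq x w.1 | x <- xs])) => //.
rewrite (_ : (fun w => _) = fun w => (fun u => phi (head (0, 0) u) (behead u))
    [seq x w | x <- snd :: [seq x \o fst | x <- xs]]); last first.
  by apply/funext => w; rewrite /= -map_comp.
apply: mphi; first by rewrite /= size_map sx.
apply: measurable_coords_cons; first exact: measurable_snd.
by apply: measurable_coords_comp => //; exact: measurable_fst.
Qed.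

Lemma cfg_measurable_section n (F : seq (R * R) -> \bar R) v :
  cfg_measurable n.+1 F -> size v = n -> measurable_fun setT (fun z : Z => F (z :: v)).
Proof.
move=> mF sv; have := mF _ Z (id :: [seq cst w | w <- v]).
rewrite /= size_map sv => /(_ erefl).
rewrite (_ : (fun t => F (t :: _)) = fun z => F (z :: v)); last first.
  by apply/funext => z; rewrite -map_comp (eq_map (g := id))// map_id.
apply; apply: measurable_coords_cons; first exact: measurable_id.
move=> i; have [iv|iv] := ltnP i (size v); last first.
  by rewrite nth_default ?size_map//; exact: measurable_cst.
by rewrite (nth_map (0, 0))//; exact: measurable_cst.
Qed.

Lemma measurable_coords_rem_at d (T : measurableType d) j (xs : seq (T -> Z)) :
  measurable_coords xs -> measurable_coords (rem_at j xs).
Proof.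
move=> mxs i; rewrite /rem_at nth_cat; case: ltnP => ij.
  by rewrite nth_take// (leq_trans ij)// size_take_min geq_minl.
by rewrite nth_drop.
Qed.

Lemma cfg_measurable_rem_at n j (phi : R * R -> seq (R * R) -> \bar R) : (j <= n)%N ->
  cfg_measurable n.+1 (fun u => phi (head (0, 0) u) (behead u)) ->
  cfg_measurable n.+1 (fun u => phi (nth (0, 0) u j) (rem_at j u)).
Proof.
move=> jn mphi d T xs sx mxs.
have := mphi _ T (nth (cst (0, 0)) xs j :: rem_at j xs).
have -> : size (nth (cst (0, 0)) xs j :: rem_at j xs) = n.+1.
  by rewrite /= size_cat size_take_min size_drop sx; lia.
move=> /(_ erefl (measurable_coords_cons (mxs j) (measurable_coords_rem_at j mxs))).
rewrite (_ : (fun h => _) = fun h : T => phi (nth (0, 0) [seq x h | x <- xs] j)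
  (rem_at j [seq x h | x <- xs]))//.
apply/funext => h /=; rewrite (nth_map (cst (0, 0))) ?sx//.
by rewrite /rem_at map_cat map_take map_drop.
Qed.

End CylinderIntegral.

(** * Landau's inequality on a circle *)

Section Landau.
Variables (R : realType) (Rad : R).
Hypothesis Rad0 : 0 < Rad.
Local Notation RM := (measurableTypeR R).
Local Notation mu := (@lebesgue_measure R).
Local Notation per := (2 * pi * Rad).
Local Notation circ := `[0, per]%classic.
Implicit Types (A B f g : R -> R) (b c y : R).

Definition mcos (m : nat) y := cos (m%:R * (y / Rad)).
Definition msin (m : nat) y := sin (m%:R * (y / Rad)).

Lemma period_gt0 : 0 < per.
Proof. by rewrite !mulr_gt0 ?pi_gt0. Qed.

Lemma continuous_phase m : continuous (fun y : R => m%:R * (y / Rad)).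
Proof. by move=> y; apply: cvgM; [exact: cvg_cst|apply: cvgM; [exact: cvg_id|exact: cvg_cst]]. Qed.

Lemma continuous_mcos m : continuous (mcos m).
Proof.
move=> y; apply: (@continuous_comp _ _ _ (fun y : R => m%:R * (y / Rad)) cos).
  exact: continuous_phase.
exact: continuous_cos.
Qed.

Lemma continuous_msin m : continuous (msin m).
Proof.
move=> y; apply: (@continuous_comp _ _ _ (fun y : R => m%:R * (y / Rad)) sin).
  exact: continuous_phase.
exact: continuous_sin.
Qed.

Lemma circ_integrable f : continuous f -> mu.-integrable circ (EFin \o f).
Proof.
move=> cf; apply: continuous_compact_integrable; first exact: segment_compact.
exact: continuous_subspaceT.
Qed.

Lemma circ_FTC f (F : R -> R) : continuous f -> (forall y, is_derive y 1 F (f y)) ->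
  (\int[mu]_(y in circ) f y = F per - F 0)%R.
Proof.
move=> cf dF.
rewrite /Rintegral (@continuous_FTC2 _ _ F _ _ period_gt0)//.
- exact: continuous_subspaceT.
- have cF y : {for y, continuous F}.
    by apply/differentiable_continuous/derivable1_diffP; have [] := dF y.
  split => [y _||].
  + by have [] := dF y.
  + exact/cvg_at_right_filter/cF.
  + exact/cvg_at_left_filter/cF.
- by move=> y _; rewrite derive1E; have [_ ->] := dF y.
Qed.

Lemma sin2npi m : sin (m%:R * (2 * pi)) = 0 :> R.
Proof.
elim: m => [|m IH]; first by rewrite mul0r sin0.
by rewrite -natr1 mulrDl mul1r [X in sin (_ + X)]mulr_natl sinD2pi.
Qed.

Lemma cos2npi m : cos (m%:R * (2 * pi)) = 1 :> R.
Proof.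
elim: m => [|m IH]; first by rewrite mul0r cos0.
by rewrite -natr1 mulrDl mul1r [X in cos (_ + X)]mulr_natl cosD2pi.
Qed.

Lemma int_mcos m : (\int[mu]_(y in circ) mcos m y = per * (m == 0%N)%:R)%R.
Proof.
case: m => [|m].
  have d (y : R) : is_derive y 1 id (mcos 0 y).
    by rewrite /mcos mul0r cos0; exact: is_derive_id.
  by rewrite (circ_FTC (@continuous_mcos 0%N) d) mulr1 subr0.
have d (y : R) : is_derive y 1 (fun y => (Rad / m.+1%:R) * msin m.+1 y) (mcos m.+1 y).
  rewrite /msin /mcos; apply: is_derive_eq.
  by rewrite /GRing.scale/=; field; rewrite gt_eqF//= pnatr_eq0.
rewrite (circ_FTC (@continuous_mcos m.+1) d).
by rewrite /msin mulfK ?gt_eqF// sin2npi mul0r !mulr0 sin0 mulr0 subr0.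
Qed.

Lemma int_msin m : (\int[mu]_(y in circ) msin m y = 0)%R.
Proof.
case: m => [|m].
  have d (y : R) : is_derive y 1 (cst 0) (msin 0 y).
    by rewrite /msin mul0r sin0; exact: is_derive_cst.
  by rewrite (circ_FTC (@continuous_msin 0%N) d) subr0.
have d (y : R) : is_derive y 1 (fun y => - (Rad / m.+1%:R) * mcos m.+1 y) (msin m.+1 y).
  rewrite /msin /mcos; apply: is_derive_eq.
  by rewrite /GRing.scale/=; field; rewrite gt_eqF//= pnatr_eq0.
rewrite (circ_FTC (@continuous_msin m.+1) d).
by rewrite /mcos mulfK ?gt_eqF// cos2npi mul0r mulr0 cos0 subrr.
Qed.

(** Real and imaginary parts of [(A + iB) exp(i m y / Rad)]. *)
Local Notation reP A B m := (fun y => A y * mcos m y - B y * msin m y).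
Local Notation imP A B m := (fun y => A y * msin m y + B y * mcos m y).

(* [A + iB] is, on the circle, a polynomial in [exp(iy/Rad)] with constant term 1. *)
Definition unit_analytic A B :=
  [/\ continuous A, continuous B &
   forall m, (\int[mu]_(y in circ) reP A B m y = per * (m == 0%N)%:R)%R /\
             (\int[mu]_(y in circ) imP A B m y = 0)%R].

Lemma unit_analytic1 : unit_analytic (cst 1) (cst 0).
Proof.
split; [exact: cst_continuous..|move=> m; split].
  by under eq_Rintegral do rewrite mul1r mul0r subr0; exact: int_mcos.
by under eq_Rintegral do rewrite mul1r mul0r addr0; exact: int_msin.
Qed.

Lemma continuousM_fun f g : continuous f -> continuous g -> continuous (fun y => f y * g y).
Proof. by move=> cf cg y; apply: cvgM; [exact: cf|exact: cg]. Qed.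

Lemma continuousD_fun f g : continuous f -> continuous g -> continuous (fun y => f y + g y).
Proof. by move=> cf cg y; apply: cvgD; [exact: cf|exact: cg]. Qed.

Lemma continuousN_fun f : continuous f -> continuous (fun y => - f y).
Proof. by move=> cf y; apply: cvgN; exact: cf. Qed.

Lemma continuous_cst_fun c : continuous (fun _ : R => c).
Proof. exact: cst_continuous. Qed.

Local Hint Resolve continuous_mcos continuous_msin continuousM_fun continuousD_fun
  continuousN_fun continuous_cst_fun : core.

Lemma circ_intD3 f g h b c : continuous f -> continuous g -> continuous h ->
  (\int[mu]_(y in circ) (f y + (b * g y + c * h y)) =
   \int[mu]_(y in circ) f y + (b * \int[mu]_(y in circ) g y + c * \int[mu]_(y in circ) h y))%R.
Proof.
move=> cf cg ch.
have mc : measurable (circ : set RM) by exact: measurable_itv.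
rewrite RintegralD//; try (by apply: circ_integrable; auto).
congr (_ + _); rewrite RintegralD//; try (by apply: circ_integrable; auto).
by rewrite !RintegralZl//; apply: circ_integrable.
Qed.

(** Real and imaginary parts of [1 - (b + ic) exp(iy / Rad)]. *)
Definition fac_re b c y := 1 - (b * cos (y / Rad) - c * sin (y / Rad)).
Definition fac_im b c y := - (b * sin (y / Rad) + c * cos (y / Rad)).

Lemma mcosS m y : mcos m.+1 y = mcos m y * cos (y / Rad) - msin m y * sin (y / Rad).
Proof. by rewrite /mcos /msin -natr1 mulrDl mul1r cosD. Qed.

Lemma msinS m y : msin m.+1 y = msin m y * cos (y / Rad) + mcos m y * sin (y / Rad).
Proof. by rewrite /mcos /msin -natr1 mulrDl mul1r sinD. Qed.

Lemma continuous_fac_re b c : continuous (fac_re b c).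
Proof.
rewrite (_ : fac_re b c = fun y => 1 + - (b * mcos 1 y + - (c * msin 1 y))); first by auto 10.
by apply/funext => y; rewrite /mcos /msin !mul1r.
Qed.

Lemma continuous_fac_im b c : continuous (fac_im b c).
Proof.
rewrite (_ : fac_im b c = fun y => - (b * msin 1 y + c * mcos 1 y)); first by auto 10.
by apply/funext => y; rewrite /mcos /msin !mul1r.
Qed.
Local Hint Resolve continuous_fac_re continuous_fac_im : core.

(** The [m]-th moment of the product with [1 - (b + ic) exp(iy / Rad)] is the old [m]-th moment
    minus [b + ic] times the [m.+1]-st one, which vanishes. *)
Lemma unit_analyticM A B b c : unit_analytic A B ->
  unit_analytic (fun y => A y * fac_re b c y - B y * fac_im b c y)
                (fun y => A y * fac_im b c y + B y * fac_re b c y).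
Proof.
move=> [cA cB H]; split; [by auto 10..|move=> m].
have cre n : continuous (reP A B n) by auto 10.
have cim n : continuous (imP A B n) by auto 10.
split.
  transitivity (\int[mu]_(y in circ)
      (reP A B m y + ((- b) * reP A B m.+1 y + c * imP A B m.+1 y)))%R.
    by apply: eq_Rintegral => y _; rewrite mcosS msinS /fac_re /fac_im; ring.
  by rewrite circ_intD3// !(H _).1 !(H _).2 !mulr0 !addr0.
transitivity (\int[mu]_(y in circ)
    (imP A B m y + ((- b) * imP A B m.+1 y + (- c) * reP A B m.+1 y)))%R.
  by apply: eq_Rintegral => y _; rewrite mcosS msinS /fac_re /fac_im; ring.
by rewrite circ_intD3// !(H _).1 !(H _).2 !mulr0 !addr0.
Qed.

(** Pointwise [A^2 + B^2 >= 2 A - 1], and [A] has mean 1 by the moment [m = 0]. *)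
Lemma unit_analytic_mean A B : unit_analytic A B ->
  (per%:E <= \int[mu]_(y in circ) (A y ^+ 2 + B y ^+ 2)%:E)%E.
Proof.
move=> [cA cB H].
have mc : measurable (circ : set RM) by exact: measurable_itv.
have cAB : continuous (fun y => A y ^+ 2 + B y ^+ 2) by apply: continuousD_fun; apply: continuousM_fun.
have cl : continuous (fun y => 2 * A y + - 1) by auto 10.
have -> : per%:E = (\int[mu]_(y in circ) (2 * A y + - 1)%:E)%E.
  have iA : (\int[mu]_(y in circ) A y = per)%R.
    have := (H 0%N).1; rewrite mulr1 => e; apply: etrans e; apply: eq_Rintegral => y _.
    by rewrite /mcos /msin mul0r cos0 sin0 mulr1 mulr0 subr0.
  have i1 : (\int[mu]_(y in circ) (- 1) = - per)%R.
    have mper : mu circ = per%:E.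
      by rewrite lebesgue_measure_itv/= lte_fin period_gt0 -EFinD subr0.
    by apply: etrans (Rintegral_cst mu mc (-1)) _; rewrite [X in fine X]mper mulN1r.
  rewrite -[RHS]fineK; last exact: (integrable_fin_num mc (circ_integrable cl)).
  congr EFin; rewrite -[RHS]/(\int[mu]_(y in circ) (2 * A y + - 1))%R.
  rewrite RintegralD//; try (by apply: circ_integrable; auto).
  by rewrite RintegralZl//; [rewrite iA i1; ring|exact: circ_integrable].
apply: le_integral => //; [exact: circ_integrable..|].
move=> y _; rewrite lee_fin.
have := sqr_ge0 (A y - 1); have := sqr_ge0 (B y); nra.
Qed.

Definition maxexp (x : R) (w : R * R) : R := Num.max (expR (x / Rad)) (expR (w.1 / Rad)).

Lemma sqmod_diff_fac x (w : R * R) : exists b c, forall y,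
  sqmod_diff Rad (x, y) w = maxexp x w ^+ 2 * (fac_re b c y ^+ 2 + fac_im b c y ^+ 2).
Proof.
rewrite /maxexp; set r := expR _; set r' := expR _.
have r0 : 0 < r by exact: expR_gt0.
have r0' : 0 < r' by exact: expR_gt0.
pose M := Num.max r r'; pose m := Num.min r r'.
have M0 : 0 < M by rewrite /M lt_max r0.
have Mm : M * m = r * r' by rewrite /M /m; case: leP => _; rewrite // mulrC.
have Mm2 : M ^+ 2 + m ^+ 2 = r ^+ 2 + r' ^+ 2.
  by rewrite /M /m; case: leP => _; rewrite // addrC.
(* [b + ic] is [(m / M) exp(- i w.2 / Rad)]. Which of the two points has the larger modulus does not
   matter, since [r^2 + r'^2 - 2 r r' cos] of the angle between them is symmetric in the moduli. *)
exists (m / M * cos (w.2 / Rad)), (- (m / M * sin (w.2 / Rad))) => y.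
rewrite /sqmod_diff /ez_re /ez_im /= -/r -/r' -/M /fac_re /fac_im.
have := cos2Dsin2 (w.2 / Rad); have := cos2Dsin2 (y / Rad).
set C := cos (w.2 / Rad); set S := sin (w.2 / Rad).
set C' := cos (y / Rad); set S' := sin (y / Rad) => e1 e2.
transitivity (r ^+ 2 * (C' ^+ 2 + S' ^+ 2) + r' ^+ 2 * (C ^+ 2 + S ^+ 2)
  - 2 * (r * r') * (C * C' + S * S')); first by ring.
rewrite e1 e2 !mulr1 -Mm -Mm2.
transitivity (M ^+ 2 + m ^+ 2 * ((C' ^+ 2 + S' ^+ 2) * (C ^+ 2 + S ^+ 2))
   - 2 * (M * m) * (C * C' + S * S')); first by rewrite e1 e2 !mulr1.
by field; rewrite gt_eqF.
Qed.

Lemma unit_analyticX A B b c p : unit_analytic A B -> exists A' B', unit_analytic A' B' /\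
  forall y, A' y ^+ 2 + B' y ^+ 2 =
    (A y ^+ 2 + B y ^+ 2) * (fac_re b c y ^+ 2 + fac_im b c y ^+ 2) ^+ p.
Proof.
move=> AB; elim: p => [|p [A' [B' [AB' E]]]].
  by exists A, B; split => // y; rewrite mulr1.
exists (fun y => A' y * fac_re b c y - B' y * fac_im b c y),
  (fun y => A' y * fac_im b c y + B' y * fac_re b c y).
split; first exact: unit_analyticM.
by move=> y; rewrite [X in _ = _ * X]exprS mulrCA -E; ring.
Qed.

Lemma prod_sqmod_diff_analytic p x (v : seq (R * R)) : exists A B, unit_analytic A B /\
  forall y, \prod_(w <- v) sqmod_diff Rad (x, y) w ^+ p =
    \prod_(w <- v) maxexp x w ^+ (2 * p) * (A y ^+ 2 + B y ^+ 2).
Proof.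
elim: v => [|w v [A [B [AB E]]]].
  exists (cst 1), (cst 0); split; first exact: unit_analytic1.
  by move=> y; rewrite !big_nil /= expr1n expr0n addr0 mulr1.
have [b [c bc]] := sqmod_diff_fac x w.
have [A' [B' [AB' E']]] := unit_analyticX b c p AB.
exists A', B'; split => // y.
by rewrite !big_cons E E' bc exprMn -exprM; ring.
Qed.

(* Landau's inequality: the Mahler measure is at most the quadratic mean. *)
Lemma integral_prod_sqmod_ge p x (v : seq (R * R)) :
  ((per * \prod_(w <- v) maxexp x w ^+ (2 * p))%:E <=
   \int[mu]_(y in angles Rad) (\prod_(w <- v) sqmod_diff Rad (x, y) w ^+ p)%:E)%E.
Proof.
have [A [B [AB E]]] := prod_sqmod_diff_analytic p x v.
have -> : angles Rad = circ by apply/seteqP; split => y; rewrite /= in_itv.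
have mc : measurable (circ : set RM) by exact: measurable_itv.
have mAB : measurable_fun (circ : set RM) (fun y => (A y ^+ 2 + B y ^+ 2)%:E).
  case: AB => cA cB _; apply/measurable_EFinP/measurable_funTS.
  by apply: continuous_measurable_fun; apply: continuousD_fun; apply: continuousM_fun.
under eq_integral do rewrite E EFinM.
rewrite (ge0_integralZl _ mc mAB); last 2 first.
- by move=> y _; rewrite lee_fin addr_ge0// sqr_ge0.
- by rewrite lee_fin; apply: prodr_ge0 => w _; rewrite exprn_ge0// le_max expR_ge0.
rewrite mulrC EFinM lee_pmul2l//; first exact: unit_analytic_mean.
rewrite lte_fin; apply: prodr_gt0 => w _.
by rewrite exprn_gt0// lt_max expR_gt0.
Qed.

End Landau.

(** * Occupation numbers *)

Section Occupation.
Local Open Scope nat_scope.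
Implicit Types (M k s t c : nat) (cs : seq nat).

Definition ndist (m n : nat) := (m - n) + (n - m).

Definition below k cs := count (fun c => c < k) cs.

(* [cs] lists the cells of the particles; [ndist (below i cs) i] is then [|K|] at site [i]. *)
Definition excess_at M k s t cs :=
  (ndist (below k cs) k == t) &&
  all (fun i => ndist (below i cs) i <= s + ndist i k) (iota 1 M).

Lemma excess_atP M k s t cs : excess_at M k s t cs ->
  ndist (below k cs) k = t /\
  forall i, 0 < i <= M -> ndist (below i cs) i <= s + ndist i k.
Proof.
case/andP=> /eqP-> /allP H; split => // i iM; apply: H.
by rewrite mem_iota; lia.
Qed.

Lemma belowS k cs : below k.+1 cs = below k cs + count_mem k cs.
Proof. by elim: cs => //= c cs IH; rewrite /below /= in IH *; lia. Qed.

Lemma below0 cs : below 0 cs = 0. Proof. by elim: cs. Qed.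

Lemma below_max M cs : all (fun c => c <= M) cs -> below M.+1 cs = size cs.
Proof. by move=> H; rewrite /below -count_predT; apply/eq_in_count => c /(allP H) /=; lia. Qed.

Lemma below_size k cs : below k cs <= size cs. Proof. exact: count_size. Qed.

(** The occupation of cell [c] is [below c.+1 cs - below c cs], hence 1 plus at most the sum of the
    excess bounds at its two end sites. The cells 0 and [M] have a single end site; there
    [below 0 cs = 0] and [below M.+1 cs = M.+1] stand in for the other one. *)
Lemma occupation_bound M k s t cs c :
  size cs = M.+1 -> all (fun c => c <= M) cs -> 0 < k <= M ->
  excess_at M k s t cs -> c <= M -> count_mem c cs <= 2 * (s + 1 + ndist c k).
Proof.
move=> sz /below_max bM kM /excess_atP[_ H] cM.
have := belowS c cs; have b0 := below0 cs; rewrite sz in bM.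
have Hc := H c; have Hc1 := H c.+1.
have [c0|c0] := posnP c.
  by subst c; rewrite /ndist in Hc1 *; lia.
have [cM'|cM'] := ltnP c M; first by rewrite /ndist in Hc Hc1 *; lia.
have eM : c = M by lia.
by rewrite eM in Hc *; rewrite bM; rewrite /ndist in Hc *; lia.
Qed.

Definition pivot_side k c cs :=
  ((c < k) && (k < below k (c :: cs))) || ((k <= c) && (below k (c :: cs) < k)).

(** The new cell [below k cs] is the number of other particles left of site [k], which is at least
    [k] in the first case of [pivot_side] and less than [k] in the second. So the move crosses site
    [k] and lowers the excess there by one, while [below] changes by at most one at any other
    site. *)
Lemma excess_at_move M k s t c cs : 0 < t -> excess_at M k s t (c :: cs) ->
  pivot_side k c cs ->
  excess_at M k s.+1 t.-1 (below k cs :: cs) /\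
  ((c < k) && (below k cs == k + t - 1) || (k <= c) && (below k cs + t == k)).
Proof.
move=> t0 /excess_atP[Ht H] Hp.
have e k' : below k' (c :: cs) = (c < k') + below k' cs by [].
have e' k' : below k' (below k cs :: cs) = (below k cs < k') + below k' cs by [].
move: Hp; rewrite /pivot_side e => Hp; rewrite e /ndist in Ht.
split; last by lia.
apply/andP; split; first by rewrite e' /ndist; lia.
apply/allP => i; rewrite mem_iota => iM; have := H i; rewrite e e' /ndist; lia.
Qed.

(** Take [k'] maximising the excess minus the distance to [k]. Comparison with [k] itself shows that
    the excess at [k'] is at least [n + ndist k k'], and [i] is the surplus; comparison with any
    other site and the triangle inequality give the linear growth around [k']. *)
Lemma excess_at_exists M k n cs : size cs = M.+1 -> 0 < k <= M -> n <= ndist (below k cs) k ->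
  exists2 k', k' \in iota 1 M & exists2 i, i \in iota 0 M.+2 &
    excess_at M k' (n + ndist k k' + i) (n + ndist k k' + i) cs.
Proof.
move=> sz kM Hn.
(* The ordinal [i] stands for site [i.+1]; the shift by [M] keeps the subtraction from being
   truncated. *)
pose f (i : 'I_M) := ndist (below i.+1 cs) i.+1 + (M - ndist i.+1 k).
have kl : k.-1 < M by lia.
have := @arg_maxnP _ (Ordinal kl) xpredT f erefl.
case=> j _ Hj; pose k' := j.+1.
have k'M : 0 < k' <= M by rewrite /k' ltn_ord.
have Hk i : 0 < i <= M ->
    ndist (below i cs) i + ndist k' k <= ndist (below k' cs) k' + ndist i k.
  move=> iM; have il : i.-1 < M by lia.
  have := Hj (Ordinal il) isT; rewrite /f /= prednK -/k'; last by lia.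
  have : ndist i k <= M by rewrite /ndist; lia.
  have : ndist k' k <= M by rewrite /ndist; lia.
  by lia.
exists k'; first by rewrite mem_iota; lia.
have hk : n + ndist k k' <= ndist (below k' cs) k'.
  have := Hk k kM; have -> : ndist k k = 0 by rewrite /ndist; lia.
  have -> : ndist k' k = ndist k k' by rewrite /ndist addnC.
  by lia.
have bM : ndist (below k' cs) k' <= M.+1.
  by have := below_size k' cs; rewrite /ndist; lia.
exists (ndist (below k' cs) k' - n - ndist k k').
  by rewrite mem_iota; lia.
have -> : n + ndist k k' + (ndist (below k' cs) k' - n - ndist k k') = ndist (below k' cs) k'.
  by lia.
rewrite /excess_at eqxx; apply/allP => i; rewrite mem_iota => iM.
have tri : ndist i k <= ndist i k' + ndist k' k by rewrite /ndist; lia.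
have iM' : 0 < i <= M by lia.
have {}Hk := Hk i iM'; move: Hk tri; clear.
by move: (ndist _ _) (ndist _ _) (ndist _ _) (ndist _ _) (ndist _ _) => *; lia.
Qed.

End Occupation.

(** * Geometric sums with linear weights *)

Section GeometricSums.
Variables (R : realType) (th : R).
Hypothesis th01 : 0 < th < 1.

Lemma geometric_sum_le n : \sum_(i < n) (1 + i%:R) * th ^+ i <= (1 - th) ^- 2.
Proof.
have [th0 th1] := andP th01.
have d0 : 0 < (1 - th) ^+ 2 by rewrite exprn_gt0 ?subr_gt0.
suff -> : \sum_(i < n) (1 + i%:R) * th ^+ i =
    (1 - th ^+ n * (1 + n%:R * (1 - th))) / (1 - th) ^+ 2.
  rewrite ler_pdivrMr// mulVf ?gt_eqF//.
  rewrite gerBl mulr_ge0 ?exprn_ge0 ?ltW// ltr_wpDr// mulr_ge0// subr_ge0 ltW//.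
elim: n => [|n IH]; first by rewrite big_ord0 expr0 mul0r addr0 mul1r subrr mul0r.
rewrite big_ord_recr /= IH [th ^+ n.+1]exprS -natr1; field.
by rewrite subr_eq0 gt_eqF.
Qed.

(** Extended to [d + n] terms and cut at [d], the sum becomes two one-sided sums, the left one read
    backwards. *)
Lemma geometric_sum_dist_le n d :
  \sum_(i < n) (1 + (ndist i d)%:R) * th ^+ (ndist i d) <= 2 * (1 - th) ^- 2.
Proof.
have [th0 th1] := andP th01.
have t0 i : 0 <= (1 + i%:R) * th ^+ i by rewrite mulr_ge0 ?exprn_ge0 ?addr_ge0// ltW.
pose F i := (1 + i%:R) * th ^+ i.
have F0 i : 0 <= F i by exact: t0.
apply: (@le_trans _ _ (\sum_(i < n + d) F (ndist i d))).
  by rewrite big_split_ord /= lerDl; apply: sumr_ge0.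
rewrite addnC big_split_ord /= mulr_natl mulr2n; apply: lerD.
  have -> : \sum_(i < d) F (ndist i d) = \sum_(i < d) F (d - i)%N.
    by apply: eq_bigr => i _; congr F; rewrite /ndist; have := ltn_ord i; lia.
  rewrite (reindex_inj rev_ord_inj) /=.
  have -> : \sum_(i < d) F (d - (d - i.+1))%N = \sum_(i < d) F i.+1.
    by apply: eq_bigr => i _; congr F; have := ltn_ord i; lia.
  apply: le_trans (geometric_sum_le d.+1); rewrite big_ord_recl /= -/F.
  by rewrite lerDr; exact: t0.
apply: le_trans (geometric_sum_le n); rewrite le_eqVlt; apply/orP; left; apply/eqP.
by apply: eq_bigr => i _; rewrite (_ : ndist (d + i) d = i)//; rewrite /ndist; lia.
Qed.

End GeometricSums.

(** * Cells and screening *)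

Section Cells.
Variables (R : realType) (Rad ell : R) (p : nat).
Hypotheses (Rad0 : 0 < Rad) (ell0 : 0 < ell) (p0 : (0 < p)%N).
Implicit Types (x y : R) (M k c : nat) (v : seq (R * R)).
Local Notation site := (xbar Rad ell p).

Definition spacing : R := p%:R * ell ^+ 2 / Rad.
Local Notation a := spacing.

Lemma spacing_gt0 : 0 < a.
Proof. by rewrite divr_gt0// mulr_gt0 ?exprn_gt0// ltr0n. Qed.

Lemma siteE k : site k = (k%:R - 2^-1) * a.
Proof. by rewrite /xbar /spacing !mulrA. Qed.

Lemma le_site j k : (j <= k)%N -> site j <= site k.
Proof. by move=> jk; rewrite !siteE ler_pM2r ?spacing_gt0// lerD2r ler_nat. Qed.

(** The sites 1 to [M] cut the line into the cells 0 to [M], the two outer ones unbounded. The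
    strict inequality closes cells on the right, in agreement with the [<=] in [Kexcess] (see
    [cell_ltE]). *)
Definition cell M x := count (fun j => site j < x) (iota 1 M).

Lemma cell_max M x : (cell M x <= M)%N.
Proof. by rewrite -[leqRHS](size_iota 1) count_size. Qed.

Lemma cell_ltE M k x : (0 < k <= M)%N -> (cell M x < k)%N = (x <= site k).
Proof.
move=> /andP[k0 kM]; rewrite /cell; case: leP => xk.
  rewrite (_ : M = (k.-1 + (M - k.-1)))%N ?iotaD; last by lia.
  rewrite count_cat [X in (_ + X)%N](_ : _ = 0%N); last first.
    apply/eqP; rewrite -leqn0 leqNgt -has_count; apply/hasPn => j.
    rewrite mem_iota -leNgt => Hj; apply: (le_trans xk); apply: le_site; lia.
  by have := count_size (fun j => site j < x) (iota 1 k.-1); rewrite size_iota; lia.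
rewrite (_ : M = (k + (M - k)))%N ?iotaD; last by lia.
rewrite count_cat (_ : count _ (iota 1 k) = k); first by lia.
rewrite -[RHS](size_iota 1) -count_predT; apply/eq_in_count => j.
by rewrite mem_iota => Hj; apply/idP; apply: (le_lt_trans _ xk); apply: le_site; lia.
Qed.

Lemma site_lt_cell M x : (0 < cell M x)%N -> site (cell M x) < x.
Proof.
move=> c0; rewrite ltNge -(@cell_ltE M) ?ltnn//.
by rewrite c0 cell_max.
Qed.

Lemma cell_le_site M x : (cell M x < M)%N -> x <= site (cell M x).+1.
Proof. by move=> cM; rewrite -(@cell_ltE M). Qed.

Lemma cell_unique M L x : (L <= M)%N -> ((0 < L)%N -> site L < x) ->
  ((L < M)%N -> x <= site L.+1) -> cell M x = L.
Proof.
move=> LM H1 H2; apply/eqP; rewrite eqn_leq; apply/andP; split.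
  have [LM'|LM'] := ltnP L M; last by rewrite (leq_trans (cell_max _ _)).
  by rewrite -ltnS cell_ltE// H2.
rewrite leqNgt; apply/negP => cL.
have L0 : (0 < L)%N by case: L cL {LM H1 H2}.
by move: cL; rewrite cell_ltE ?L0// leNgt H1.
Qed.

(** Points of cells [c < c'] are separated by the sites [c + 1] to [c'], which span
    [(c' - c - 1) a]; hence the extra [a]. *)
Lemma cell_dist M x x' : (ndist (cell M x) (cell M x'))%:R * a <= `|x - x'| + a.
Proof.
wlog cc : x x' / (cell M x <= cell M x')%N.
  move=> H; have [/H//|/ltnW/H] := leqP (cell M x) (cell M x').
  by rewrite distrC /ndist addnC.
have a0 := spacing_gt0; move: cc; rewrite leq_eqVlt => /predU1P[->|cc].
  by rewrite /ndist subnn mul0r addr_ge0// ltW.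
have h1 : site (cell M x') < x' by apply: site_lt_cell; lia.
have h2 : x <= site (cell M x).+1.
  by apply: cell_le_site; have := cell_max M x'; lia.
have -> : ndist (cell M x) (cell M x') = (cell M x' - cell M x)%N by rewrite /ndist; lia.
rewrite natrB ?(ltnW cc)//; rewrite !siteE -natr1 in h1 h2.
have h3 : x' - x <= `|x - x'| by rewrite distrC ler_norm.
nra.
Qed.

Lemma cell_dist_site M k x : (0 < k <= M)%N ->
  (ndist (cell M x) k)%:R * a <= `|x - site k| + a.
Proof.
move=> kM; have a0 := spacing_gt0.
have [ck|ck] := ltnP (cell M x) k.
  have h2 : x <= site (cell M x).+1 by apply: cell_le_site; lia.
  have -> : ndist (cell M x) k = (k - cell M x)%N by rewrite /ndist; lia.
  rewrite natrB ?(ltnW ck)//.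
  have h3 : site k - x <= `|x - site k| by rewrite distrC ler_norm.
  rewrite !siteE -natr1 in h2 h3 *; nra.
have h1 : site (cell M x) < x by apply: site_lt_cell; lia.
have -> : ndist (cell M x) k = (cell M x - k)%N by rewrite /ndist; lia.
rewrite natrB//.
have h3 : x - site k <= `|x - site k| by rewrite ler_norm.
rewrite !siteE in h1 h3 *; nra.
Qed.

Definition cells M v := [seq cell M w.1 | w <- v].

Definition decay : R := expR (- (a / Rad)).

Lemma decay01 : 0 < decay < 1.
Proof. by rewrite expR_gt0 expR_lt1 oppr_lt0 divr_gt0// spacing_gt0. Qed.

(** [decay^-1] pays for the extra [a] of [cell_dist]; one factor 2 is that of the occupation bound,
    the other that of [geometric_sum_dist_le]. *)
Definition screening : R := 4 * (decay^-1 * (1 - decay) ^- 2).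

Lemma screening_gt0 : 0 < screening.
Proof.
have [d0 d1] := andP decay01.
by rewrite !mulr_gt0 ?invr_gt0 ?exprn_gt0 ?subr_gt0.
Qed.

Lemma sum_by_cell (F : nat -> R) M (cs : seq nat) : all (fun c => (c <= M)%N) cs ->
  \sum_(c <- cs) F c = \sum_(i < M.+1) (count_mem (i : nat) cs)%:R * F i.
Proof.
elim: cs => [|c cs IH] /=.
  by rewrite big_nil big1// => i _; rewrite mul0r.
case/andP=> cM /IH E; rewrite big_cons E.
under [RHS]eq_bigr do rewrite natrD mulrDl.
rewrite big_split /=; congr (_ + _).
have cM' : (c < M.+1)%N by [].
rewrite (bigD1 (Ordinal cM'))//= eqxx mul1r big1 ?addr0// => i ic.
rewrite (_ : (c == i) = false) ?mul0r//.
by apply/negP => /eqP ci; move/eqP: ic; apply; apply/val_inj.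
Qed.

(** Sorted by cells, the terms decay geometrically in the distance to the cell of [x], while the
    occupations grow only linearly. *)
Lemma sum_exp_dist_le M k s x v :
  (forall c, (c <= M)%N -> (count_mem c (cells M v) <= 2 * (s + 1 + ndist c k))%N) ->
  \sum_(w <- v) expR (- (`|x - w.1| / Rad)) <=
  screening * (s + 1 + ndist (cell M x) k)%:R.
Proof.
move=> H; have [d0 d1] := andP decay01; set c0 := cell M x.
apply: (@le_trans _ _ (\sum_(c <- cells M v) decay^-1 * decay ^+ (ndist c c0))).
  rewrite big_map; apply: ler_sum => w _.
  rewrite -expRN -expRM_natl -expRD ler_expR.
  rewrite -(ler_pM2r Rad0) mulNr divfK ?gt_eqF// mulrDl opprK divfK ?gt_eqF//.
  rewrite mulrN -mulr_natl mulNr -mulrA divfK ?gt_eqF//.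
  have := cell_dist M x w.1; rewrite -/c0 /ndist addnC; lra.
rewrite (@sum_by_cell (fun c => decay^-1 * decay ^+ (ndist c c0)) M); last first.
  by apply/allP => c /mapP[w _ ->]; exact: cell_max.
apply: (@le_trans _ _ (\sum_(i < M.+1) (2 * (s + 1 + ndist c0 k)%:R * decay^-1) *
    ((1 + (ndist i c0)%:R) * decay ^+ (ndist i c0)))).
  apply: ler_sum => i _; rewrite !mulrA; apply: ler_wpM2r; first by rewrite exprn_ge0// ltW.
  rewrite [leRHS]mulrAC; apply: ler_wpM2r; first by rewrite invr_ge0 ltW.
  rewrite -natr1 natr1 -!natrM -(natrD _ 1) -natrM ler_nat.
  apply: leq_trans (H i _) _; first by rewrite -ltnS.
  (* With [d0 = ndist c0 k] and [d = ndist i c0], the bound used is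
     [s + 1 + d0 + d <= (s + 1 + d0) (1 + d)]. *)
  rewrite -mulnA leq_mul2l /=.
  have : (ndist i k <= ndist c0 k + ndist i c0)%N by rewrite /ndist; lia.
  nia.
rewrite -mulr_sumr.
apply: le_trans (ler_wpM2l _ (geometric_sum_dist_le decay01 _ _)) _.
  by rewrite !mulr_ge0// invr_ge0 ltW.
by rewrite /screening le_eqVlt; apply/orP; left; apply/eqP; ring.
Qed.

End Cells.

(** * The one-particle density *)

Section Density.
Variables (R : realType) (Rad ell : R) (p : nat).
Hypotheses (Rad0 : 0 < Rad) (ell0 : 0 < ell) (p0 : (0 < p)%N).
Implicit Types (x y : R) (z w : R * R) (M k c s t : nat) (v : seq (R * R)).
Local Notation site := (xbar Rad ell p).
Local Notation a := (spacing Rad ell p).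
Local Notation Lsq := (laughlin_sq Rad ell p).

Definition one_body z v : R :=
  \prod_(w <- v) sqmod_diff Rad z w ^+ p * expR (- (z.1 ^+ 2 / ell ^+ 2)).

Lemma sqmod_diffC z w : sqmod_diff Rad z w = sqmod_diff Rad w z.
Proof. by rewrite /sqmod_diff; ring. Qed.

Lemma sqmod_diff_ge0 z w : 0 <= sqmod_diff Rad z w.
Proof. by rewrite addr_ge0// sqr_ge0. Qed.

Lemma one_body_ge0 z v : 0 <= one_body z v.
Proof.
by rewrite mulr_ge0 ?expR_ge0//; apply: prodr_ge0 => w _; rewrite exprn_ge0// sqmod_diff_ge0.
Qed.

Lemma prod_nth (F : R * R -> R) v :
  \prod_(i < size v) F (nth (0, 0) v i) = \prod_(w <- v) F w.
Proof. by rewrite (big_nth (0, 0)) big_mkord. Qed.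

Lemma laughlin_sq_cons z v : Lsq (z :: v) = one_body z v * Lsq v.
Proof.
rewrite /laughlin_sq /one_body /= big_ord_recl /= [in LHS]big_ord_recl /=.
rewrite [X in X * _ * _](_ : _ = \prod_(w <- v) sqmod_diff Rad z w ^+ p); last first.
  rewrite big_mkcond big_ord_recl /= mul1r -prod_nth.
  by apply: eq_bigr => i _; rewrite ?lift0.
rewrite [X in _ * X * _](_ : _ = \prod_(j < size v) \prod_(k < size v | (j < k)%N)
      sqmod_diff Rad (nth (0, 0) v j) (nth (0, 0) v k) ^+ p); last first.
  apply: eq_bigr => i _; rewrite big_mkcond big_ord_recl /= mul1r [RHS]big_mkcond.
  by apply: eq_bigr => j _; rewrite ?lift0 ?ltnS.
by rewrite opprD mulrDl expRD !mulNr; ring.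
Qed.

Lemma perm_rem_at j v : (j < size v)%N -> perm_eq v (nth (0, 0) v j :: rem_at j v).
Proof.
move=> jv; rewrite -{1}(cat_take_drop j v) (drop_nth (0, 0))//.
by rewrite perm_catC /= perm_cons perm_catC.
Qed.

Lemma laughlin_sq_rem_at j v : (j < size v)%N ->
  Lsq v = one_body (nth (0, 0) v j) (rem_at j v) * Lsq (rem_at j v).
Proof.
elim: j v => [|j IH] [//|z v] jv; first by rewrite /rem_at /= drop0 laughlin_sq_cons.
have {}jv : (j < size v)%N by [].
rewrite (_ : rem_at j.+1 (z :: v) = z :: rem_at j v)//= !laughlin_sq_cons (IH v jv).
rewrite /one_body (perm_big _ (perm_rem_at jv)) /= !big_cons sqmod_diffC.
by ring.
Qed.

Lemma laughlin_sq_ge0 v : 0 <= Lsq v.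
Proof.
elim: v => [|z v IH]; last by rewrite laughlin_sq_cons mulr_ge0// one_body_ge0.
by rewrite /laughlin_sq mulr_ge0 ?expR_ge0// big_ord0.
Qed.

(** Triangle inequality for moduli, in the form [2 + 2 cos >= 0] for the angle between the points,
    which is a sum of two squares. *)
Lemma sqmod_diff_le z w :
  sqmod_diff Rad z w <= (expR (z.1 / Rad) + expR (w.1 / Rad)) ^+ 2.
Proof.
rewrite /sqmod_diff /ez_re /ez_im.
have := cos2Dsin2 (w.2 / Rad); have := cos2Dsin2 (z.2 / Rad).
have := expR_gt0 (z.1 / Rad); have := expR_gt0 (w.1 / Rad).
set r := expR (z.1 / Rad); set r' := expR (w.1 / Rad).
set C := cos (w.2 / Rad); set S := sin (w.2 / Rad).
set C' := cos (z.2 / Rad); set S' := sin (z.2 / Rad) => r0' r0 e1 e2.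
have -> : (r' * C - r * C') ^+ 2 + (r' * S - r * S') ^+ 2 =
   r ^+ 2 * (C' ^+ 2 + S' ^+ 2) + r' ^+ 2 * (C ^+ 2 + S ^+ 2)
  - 2 * (r * r') * (C * C' + S * S') by ring.
rewrite e1 e2.
have h : 0 <= 2 + 2 * (C * C' + S * S').
  have -> : 2 + 2 * (C * C' + S * S') = (C + C') ^+ 2 + (S + S') ^+ 2.
    transitivity ((C' ^+ 2 + S' ^+ 2) + (C ^+ 2 + S ^+ 2) + 2 * (C * C' + S * S')); last by ring.
    by rewrite e1 e2; ring.
  by rewrite addr_ge0// sqr_ge0.
have := mulr_ge0 (ltW (mulr_gt0 r0 r0')) h; nra.
Qed.

(** Factor by factor. In [exp(x / Rad) + exp(w.1 / Rad)] the larger term is factored out and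
    [1 + e <= exp e] is applied to the ratio [e = exp(- |x - w.1| / Rad)]. For [w] on the left the
    larger term is [exp(x / Rad)], and replacing [x] by [x'] costs [exp((x - x') / Rad)]; on the
    right it is [exp(w.1 / Rad)], already below [maxexp] at [x']. *)
Lemma prod_sqmod_le (left : pred (R * R)) x y x' v :
  {in v, forall w, left w -> w.1 <= x} -> {in v, forall w, ~~ left w -> x <= w.1} ->
  \prod_(w <- v) sqmod_diff Rad (x, y) w ^+ p <=
  expR ((2 * p)%:R * ((count left v)%:R * ((x - x') / Rad) +
                      \sum_(w <- v) expR (- (`|x - w.1| / Rad)))) *
  \prod_(w <- v) maxexp Rad x' w ^+ (2 * p).
Proof.
elim: v => [|w v IH] H1 H2.
  by rewrite !big_nil mul0r addr0 mulr0 expR0 mulr1.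
have H1' : {in v, forall w, left w -> w.1 <= x}.
  by move=> w' w'v; apply: H1; rewrite inE w'v orbT.
have H2' : {in v, forall w, ~~ left w -> x <= w.1}.
  by move=> w' w'v; apply: H2; rewrite inE w'v orbT.
have {}IH := IH H1' H2'.
have m0 : 0 < maxexp Rad x' w by rewrite lt_max expR_gt0.
have fac : expR (x / Rad) + expR (w.1 / Rad) <=
    expR ((left w)%:R * ((x - x') / Rad) + expR (- (`|x - w.1| / Rad))) * maxexp Rad x' w.
  have wv : w \in w :: v by rewrite mem_head.
  case: (boolP (left w)) => lw.
    have wx := H1 w wv lw.
    rewrite mul1r expRD ger0_norm ?subr_ge0//.
    apply: (@le_trans _ _ (expR (x / Rad) * expR (expR (- ((x - w.1) / Rad))))).
      apply: le_trans (ler_wpM2l (expR_ge0 _) (expR_ge1Dx _)).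
      by rewrite mulrDr mulr1 -expRD mulrBl opprB addrCA subrr addr0.
    rewrite mulrAC; apply: ler_wpM2r; first exact: expR_ge0.
    apply: (@le_trans _ _ (expR ((x - x') / Rad) * expR (x' / Rad))).
      by rewrite -expRD -mulrDl subrK.
    by rewrite ler_wpM2l ?expR_ge0// le_max lexx.
  have xw := H2 w wv lw.
  rewrite mul0r add0r ler0_norm ?subr_le0// opprB.
  apply: (@le_trans _ _ (expR (expR (- ((w.1 - x) / Rad))) * expR (w.1 / Rad))).
    apply: le_trans (ler_wpM2r (expR_ge0 _) (expR_ge1Dx _)).
    by rewrite mulrDl mul1r -expRD mulrBl opprB subrK addrC.
  by rewrite ler_wpM2l ?expR_ge0// le_max lexx orbT.
rewrite !big_cons /= natrD.
set E := \sum_(i <- v) _ in IH *; set P := \prod_(i <- v) maxexp _ _ _ ^+ _ in IH *.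
have -> : (2 * p)%:R * (((left w)%:R + (count left v)%:R) * ((x - x') / Rad) +
   (expR (- (`|x - w.1| / Rad)) + E)) =
   (2 * p)%:R * ((left w)%:R * ((x - x') / Rad) + expR (- (`|x - w.1| / Rad))) +
   (2 * p)%:R * ((count left v)%:R * ((x - x') / Rad) + E) by ring.
rewrite expRD mulrACA; apply: ler_pM => //.
- by rewrite exprn_ge0// sqmod_diff_ge0.
- by apply: prodr_ge0 => i _; rewrite exprn_ge0// sqmod_diff_ge0.
apply: (@le_trans _ _ ((expR (x / Rad) + expR (w.1 / Rad)) ^+ (2 * p))).
  by rewrite exprM lerXn2r ?nnegrE ?sqmod_diff_ge0 ?sqr_ge0//; exact: sqmod_diff_le.
by rewrite expRM_natl -exprMn lerXn2r// nnegrE ?mulr_ge0 ?addr_ge0 ?expR_ge0// ltW.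
Qed.

(** By [integral_prod_sqmod_ge], a lower bound for the mean of [one_body (x, y) v] over the angle
    [y]. *)
Definition one_body_max x v : R :=
  \prod_(w <- v) maxexp Rad x w ^+ (2 * p) * expR (- (x ^+ 2 / ell ^+ 2)).

Lemma one_body_max_ge0 x v : 0 <= one_body_max x v.
Proof.
rewrite mulr_ge0 ?expR_ge0//; apply: prodr_ge0 => w _.
by rewrite exprn_ge0// le_max expR_ge0.
Qed.

(* Completing the square: with [L] particles to the left of it, a particle at [x]
   sees a harmonic well centred at [L a]. *)
Lemma one_body_le (left : pred (R * R)) x y x' (c : R) v :
  c = (count left v)%:R * a ->
  {in v, forall w, left w -> w.1 <= x} -> {in v, forall w, ~~ left w -> x <= w.1} ->
  one_body (x, y) v <=
  expR (((x' - c) ^+ 2 - (x - c) ^+ 2) / ell ^+ 2 +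
        (2 * p)%:R * \sum_(w <- v) expR (- (`|x - w.1| / Rad))) * one_body_max x' v.
Proof.
move=> cE H1 H2; rewrite /one_body /one_body_max /=.
have := ler_wpM2r (expR_ge0 (- (x ^+ 2 / ell ^+ 2))) (prod_sqmod_le y x' H1 H2).
move/le_trans; apply; set P := \prod_(i <- v) _; set E := \sum_(i <- v) _.
rewrite [leLHS]mulrAC -expRD (mulrC P) [leRHS]mulrA -expRD le_eqVlt; apply/orP; left.
(* With [L = count left v], [2 p L (x - x') / Rad = 2 c (x - x') / ell^2] is the cross term in the
   difference of the two squares. *)
apply/eqP; congr (expR _ * _); rewrite cE /spacing natrM; field.
by rewrite !gt_eqF.
Qed.

(** No particle on the same side of site [k] as [z] lies strictly between [z] and the site. Thus the
    particles left of the site are exactly the set [left] that [one_body_le] requires. *)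
Definition extremal M k z v :=
  all (fun w => if (cell Rad ell p M z.1 < k)%N
    then ((cell Rad ell p M w.1 < k)%N ==> (w.1 <= z.1))
    else ((k <= cell Rad ell p M w.1)%N ==> (z.1 <= w.1))) v.

Definition wgt : R := (2 * p)%:R * screening Rad ell p.
(** Both a quarter of the energy [(t a / 2)^2 / ell^2] at [t = 1] and the full energy
    [(a / 4)^2 / ell^2] at the edge of the window of new positions. *)
Definition rate : R := a ^+ 2 / (16 * ell ^+ 2).
(** In order: the short-range terms near site [k], the remainder of a completed square, the energy
    of the new position, and the gain. *)
Definition exchange_exponent s t : R := wgt * (s + 2)%:R + (wgt * ell / a) ^+ 2 + rate - rate * t%:R ^+ 2.

Lemma one_body_pivot_le M k s t x y x' (c : R) v :
  c = (below k (cells Rad ell p M v))%:R * a ->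
  (0 < k <= M)%N -> (0 < t)%N -> size v = M ->
  excess_at M k s t (cells Rad ell p M ((x, y) :: v)) ->
  pivot_side k (cell Rad ell p M x) (cells Rad ell p M v) ->
  extremal M k (x, y) v ->
  `|x' - c| <= a / 4 ->
  one_body (x, y) v <= expR (exchange_exponent s t) * normal_fun c ell x * one_body_max x' v.
Proof.
move=> cE kM t0 sv ex pv /allP ext x'c.
have a0 : 0 < a by exact: spacing_gt0.
pose left := fun w : R * R => (cell Rad ell p M w.1 < k)%N.
have cE' : c = (count left v)%:R * a by rewrite cE /below /cells count_map.
have side : let b := below k (cells Rad ell p M v) in let cx := cell Rad ell p M x in
    (cx < k)%N && (b == k + t - 1)%N || (k <= cx)%N && (b + t == k)%N.
  by case: (excess_at_move t0 ex pv).
have H1 : {in v, forall w, left w -> w.1 <= x}.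
  move=> w wv lw; have := ext w wv; rewrite /= -/(left w) lw /=.
  case: ifPn => //; rewrite (cell_ltE Rad0 ell0 p0 _ kM) -ltNge => /ltW xk _.
  by apply: le_trans xk; rewrite -(cell_ltE Rad0 ell0 p0 _ kM).
have H2 : {in v, forall w, ~~ left w -> x <= w.1}.
  move=> w wv lw; have := ext w wv; rewrite /= [(k <= _)%N]leqNgt -/(left w) lw /=.
  case: ifPn => //; rewrite (cell_ltE Rad0 ell0 p0 _ kM) => xk _.
  apply: (le_trans xk); move: lw; rewrite /left (cell_ltE Rad0 ell0 p0 _ kM) -ltNge.
  exact: ltW.
apply: le_trans (one_body_le y x' cE' H1 H2) _.
apply: ler_wpM2r; first exact: one_body_max_ge0.
rewrite /normal_fun -expRD ler_expR.
have occ c' : (c' <= M)%N -> (count_mem c' (cells Rad ell p M v) <= 2 * (s + 1 + ndist c' k))%N.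
  move=> c'M; apply: leq_trans (occupation_bound _ _ kM ex c'M).
  - by rewrite /= leq_addl.
  - by rewrite /= size_map sv.
  - by rewrite /= cell_max; apply/allP => i /mapP[w _ ->]; exact: cell_max.
have sumle := sum_exp_dist_le Rad0 ell0 p0 x occ.
set Sg := \sum_(w <- v) _ in sumle *.
set u := x - c.
have ta : a <= t%:R * a by rewrite ler_peMl ?ler1n// ltW.
(* Site [k] lies between [x] and the centre [c], which is [(k + t - 1) a] or [(k - t) a], so [|u|]
   is at least [(t - 1/2) a >= t a / 2]. *)
have [xu tu] : `|x - site k| <= `|u| /\ t%:R * a / 2 <= `|u|.
  rewrite /u cE siteE//; case/orP: side => /andP[].
    rewrite (cell_ltE Rad0 ell0 p0 _ kM) siteE// => xk /eqP->.
    have -> : (k + t - 1)%:R * a = k%:R * a + t%:R * a - a.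
      by rewrite natrB ?natrD; [ring|lia].
    rewrite mulrBl in xk *.
    rewrite !ler0_norm; [split|..]; lra.
  rewrite leqNgt (cell_ltE Rad0 ell0 p0 _ kM) siteE// -ltNge => xk /eqP Lk.
  have {Lk} : k%:R * a = (below k (cells Rad ell p M v))%:R * a + t%:R * a.
    by rewrite -mulrDl -natrD Lk.
  rewrite mulrBl in xk *; set L := (below k _)%:R * a => Lk.
  rewrite !ger0_norm; [split|..]; lra.
have nd : (ndist (cell Rad ell p M x) k)%:R <= `|u| / a + 1.
  rewrite -(ler_pM2r a0) mulrDl mul1r divfK ?gt_eqF//.
  by apply: le_trans (cell_dist_site Rad0 ell0 p0 x kM) _; rewrite lerD2r.
have S0 : 0 < screening Rad ell p by exact: screening_gt0.
have W0 : 0 < wgt by rewrite mulr_gt0// ltr0n muln_gt0.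
have h1 : (2 * p)%:R * Sg <= wgt * (s + 2)%:R + wgt * (`|u| / a).
  apply: (@le_trans _ _ (wgt * (s + 1 + ndist (cell Rad ell p M x) k)%:R)).
    by rewrite /wgt -mulrA ler_wpM2l.
  rewrite -mulrDr; apply: ler_wpM2l; first exact: ltW.
  by rewrite (natrD _ (s + 1)) (natrD _ s 1) (natrD _ s 2); lra.
have h2 : wgt * (`|u| / a) <= u ^+ 2 / (4 * ell ^+ 2) + (wgt * ell / a) ^+ 2.
  have := sqr_ge0 (`|u| / (2 * ell) - wgt * ell / a).
  have -> : (`|u| / (2 * ell) - wgt * ell / a) ^+ 2 =
     `|u| ^+ 2 / (4 * ell ^+ 2) + (wgt * ell / a) ^+ 2 - wgt * (`|u| / a).
    by field; rewrite !gt_eqF.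
  by rewrite real_normK ?num_real//; lra.
have h3 : rate * t%:R ^+ 2 <= u ^+ 2 / (4 * ell ^+ 2).
  have -> : rate * t%:R ^+ 2 = (t%:R * a / 2) ^+ 2 / (4 * ell ^+ 2).
    by rewrite /rate; field; rewrite gt_eqF.
  apply: ler_wpM2r; first by rewrite invr_ge0 mulr_ge0 ?sqr_ge0.
  rewrite -[u ^+ 2]real_normK ?num_real// lerXn2r ?nnegrE//.
  by apply: divr_ge0 => //; apply: mulr_ge0 => //; exact: ltW.
have h4 : (x' - c) ^+ 2 / ell ^+ 2 <= rate.
  rewrite (_ : rate = (a / 4) ^+ 2 / ell ^+ 2); last by rewrite /rate; field; rewrite gt_eqF.
  apply: ler_wpM2r; first by rewrite invr_ge0 sqr_ge0.
  by rewrite -[(x' - c) ^+ 2]real_normK ?num_real// lerXn2r ?nnegrE// divr_ge0// ltW.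
(* Budget of the energy [u^2 / ell^2]: one quarter absorbs the short-range terms linear in [|u|]
   ([h2]), one quarter gives the gain ([h3]), and one half stays as a Gaussian in [x], to be
   integrated. *)
have -> : - u ^+ 2 / (ell ^+ 2 *+ 2) = - (u ^+ 2 / ell ^+ 2) + 2 * (u ^+ 2 / (4 * ell ^+ 2)).
  by rewrite -mulr_natr; field; rewrite gt_eqF.
rewrite /exchange_exponent mulrBl; lra.
Qed.

End Density.

(** * Measurability of cells, pivots and densities *)

Section Measurability.
Variables (R : realType) (Rad ell : R) (p : nat).
Hypotheses (Rad0 : 0 < Rad) (ell0 : 0 < ell) (p0 : (0 < p)%N).
Local Notation RM := (measurableTypeR R).
Local Notation Z := (RM * RM)%type.
Local Notation site := (xbar Rad ell p).
Local Notation cell := (cell Rad ell p).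
Local Notation cells := (cells Rad ell p).
Local Notation Lsq := (laughlin_sq Rad ell p).
Context d (T : measurableType d).
Implicit Types (x : T -> Z) (xs : seq (T -> Z)).

Lemma measurable_natr (b : T -> bool) : measurable_fun setT b ->
  measurable_fun setT (fun t => (b t)%:R : R).
Proof.
move=> mb; rewrite (_ : (fun t => _) = fun t => if b t then 1 else 0 : R).
  exact: measurable_fun_ifT.
by apply/funext => t; case: (b t).
Qed.

Lemma measurable_has (I : Type) (s : seq I) (b : I -> T -> bool) :
  (forall i, measurable_fun setT (b i)) -> measurable_fun setT (fun t => has (b^~ t) s).
Proof.
move=> mb; elim: s => [|i s IH] /=; first exact: measurable_cst.
exact: measurable_or.
Qed.

Lemma measurable_cell_lt M k x : measurable_fun setT x ->
  measurable_fun setT (fun t => (cell M (x t).1 < k)%N).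
Proof.
move=> mx; have [k0|k0] := posnP k.
  by rewrite (_ : (fun t => _) = cst false)//; apply/funext => t; rewrite k0.
have [kM|kM] := leqP k M; last first.
  rewrite (_ : (fun t => _) = cst true)//; apply/funext => t.
  by rewrite (leq_ltn_trans (cell_max _ _ _ _ _)).
rewrite (_ : (fun t => _) = fun t => (x t).1 <= site k).
  apply: measurable_fun_ler; last exact: measurable_cst.
  by apply: measurableT_comp => //; exact: measurable_fst.
by apply/funext => t; rewrite cell_ltE// k0.
Qed.

Lemma measurable_cell_eq M i x : measurable_fun setT x ->
  measurable_fun setT (fun t => cell M (x t).1 == i).
Proof.
move=> mx; rewrite (_ : (fun t => _) =
  fun t => (cell M (x t).1 < i.+1)%N && ~~ (cell M (x t).1 < i)%N).
  apply: measurable_and; first exact: measurable_cell_lt.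
  by apply: measurable_neg; exact: measurable_cell_lt.
by apply/funext => t; rewrite ltnS -leqNgt eqn_leq.
Qed.

(** Cells take finitely many values, so any predicate of them is a finite disjunction over the cell
    of the first point. *)
Lemma measurable_cells M (P : seq nat -> bool) xs : measurable_coords xs ->
  measurable_fun setT (fun t => P (cells M [seq x t | x <- xs])).
Proof.
elim: xs P => [|x xs IH] P mxs; first exact: (measurable_cst (P [::])).
have [mx {}mxs] := measurable_coords_consP mxs.
rewrite (_ : (fun t => _) = fun t => has (fun i => (cell M (x t).1 == i) &&
    P (i :: cells M [seq x t | x <- xs])) (iota 0 M.+1)).
  apply: measurable_has => i; apply: measurable_and; first exact: measurable_cell_eq.
  exact: (IH (fun cs => P (i :: cs))).
apply/funext => t; apply/idP/hasP.
  move=> Pt; exists (cell M (x t).1); last by rewrite eqxx.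
  by rewrite mem_iota ltnS cell_max.
by case=> i _ /andP[/eqP <-].
Qed.

Lemma measurable_extremal M k x xs : measurable_fun setT x -> measurable_coords xs ->
  measurable_fun setT (fun t => extremal Rad ell p M k (x t) [seq x t | x <- xs]).
Proof.
move=> mx; elim: xs => [|x' xs IH] mxs; first exact: (measurable_cst true).
have [mx' {}mxs] := measurable_coords_consP mxs.
apply: measurable_and; last exact: IH.
have mf y : measurable_fun setT y -> measurable_fun setT (fun t : T => (y t : Z).1).
  by move=> my; apply: measurableT_comp => //; exact: measurable_fst.
have impE b1 b2 : (b1 ==> b2) = ~~ b1 || b2 by case: b1.
apply: measurable_fun_ifT; first exact: measurable_cell_lt.
- under eq_fun do rewrite impE.
  apply: measurable_or; first by apply: measurable_neg; exact: measurable_cell_lt.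
  by apply: measurable_fun_ler; exact: mf.
- under eq_fun do rewrite impE leqNgt negbK.
  apply: measurable_or; first exact: measurable_cell_lt.
  by apply: measurable_fun_ler; exact: mf.
Qed.

Lemma measurable_one_body x xs : measurable_fun setT x -> measurable_coords xs ->
  measurable_fun setT (fun t => one_body Rad ell p (x t) [seq x t | x <- xs]).
Proof.
move=> mx mxs.
have mf y : measurable_fun setT y -> measurable_fun setT (fun t : T => (y t : Z).1).
  by move=> my; apply: measurableT_comp => //; exact: measurable_fst.
have ms y : measurable_fun setT y -> measurable_fun setT (fun t : T => (y t : Z).2).
  by move=> my; apply: measurableT_comp => //; exact: measurable_snd.
have mre y : measurable_fun setT y -> measurable_fun setT (fun t : T => ez_re Rad (y t)).
  move=> my; apply: measurable_funM.
    apply: measurableT_comp; first exact: measurable_expR.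
    by apply: measurable_funM; [exact: mf|exact: measurable_cst].
  apply: measurableT_comp; first by apply: continuous_measurable_fun; exact: continuous_cos.
  by apply: measurable_funM; [exact: ms|exact: measurable_cst].
have mim y : measurable_fun setT y -> measurable_fun setT (fun t : T => ez_im Rad (y t)).
  move=> my; apply: measurable_funM.
    apply: measurableT_comp; first exact: measurable_expR.
    by apply: measurable_funM; [exact: mf|exact: measurable_cst].
  apply: measurableT_comp; first by apply: continuous_measurable_fun; exact: continuous_sin.
  by apply: measurable_funM; [exact: ms|exact: measurable_cst].
apply: measurable_funM; last first.
  apply: measurableT_comp; first exact: measurable_expR.
  apply: measurableT_comp => //; apply: measurable_funM; last exact: measurable_cst.
  by apply: measurable_funX; exact: mf.
elim: xs mxs => [|x' xs IH] mxs.
  by under eq_fun do rewrite big_nil; exact: measurable_cst.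
have [mx' {}mxs] := measurable_coords_consP mxs.
under eq_fun do rewrite /= big_cons.
apply: measurable_funM; last exact: IH.
apply: measurable_funX; apply: measurable_funD; apply: measurable_funX; apply: measurable_funB.
- exact: mre.
- exact: mre.
- exact: mim.
- exact: mim.
Qed.

Lemma measurable_laughlin_sq xs : measurable_coords xs ->
  measurable_fun setT (fun t => Lsq [seq x t | x <- xs]).
Proof.
elim: xs => [|x xs IH] mxs; first exact: (measurable_cst (Lsq [::])).
have [mx {}mxs] := measurable_coords_consP mxs.
under eq_fun do rewrite /= laughlin_sq_cons.
by apply: measurable_funM; [exact: measurable_one_body|exact: IH].
Qed.

End Measurability.

(** * Moving one particle *)

Section Exchange.
Variables (R : realType) (Rad ell : R) (p : nat).
Hypotheses (Rad0 : 0 < Rad) (ell0 : 0 < ell) (p0 : (0 < p)%N).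
Local Notation RM := (measurableTypeR R).
Local Notation Z := (RM * RM)%type.
Local Notation mu := (@lebesgue_measure R).
Local Notation cell := (cell Rad ell p).
Local Notation cells := (cells Rad ell p).
Local Notation Lsq := (laughlin_sq Rad ell p).
Local Notation a := (spacing Rad ell p).
Local Notation per := (2 * pi * Rad).
Local Notation one_body := (one_body Rad ell p).
Implicit Types (z w : R * R) (v : seq (R * R)).

Lemma lebesgue_measure_angles : mu (angles Rad) = per%:E.
Proof.
have -> : angles Rad = `[0, per]%classic by apply/seteqP; split => y; rewrite /= in_itv.
by rewrite lebesgue_measure_itv/= lte_fin period_gt0// -EFinD subr0.
Qed.

Lemma zint_normal (K c : R) : 0 <= K ->
  zint Rad (fun z => (K * normal_fun c ell z.1)%:E) = (K * per / normal_peak ell)%:E.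
Proof.
move=> K0; have ell0' : ell != 0 by rewrite gt_eqF.
have pk0 := normal_peak_gt0 ell0'.
rewrite /zint.
transitivity (\int[mu]_x ((K * per / normal_peak ell)%:E * (normal_pdf c ell x)%:E))%E.
  apply: eq_integral => x _.
  apply: etrans (integral_cst mu (measurable_angles Rad) (K * normal_fun c ell x)%:E) _.
  rewrite [X in (_ * X)%E]lebesgue_measure_angles -!EFinM normal_pdfE//; congr EFin.
  by field; rewrite gt_eqF.
rewrite ge0_integralZl//.
- by rewrite integral_normal_pdf mule1.
- by apply/measurable_EFinP; exact: measurable_normal_pdf.
- by move=> x _; rewrite lee_fin normal_pdf_ge0.
- by rewrite lee_fin !mulr_ge0 ?invr_ge0 ?pi_ge0// ltW.
Qed.

Section OneStep.
Variables (M k s t : nat).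
Hypotheses (kM : (0 < k <= M)%N) (t0 : (0 < t)%N).

Definition source z v : R :=
  [&& excess_at M k s t (cells M (z :: v)), pivot_side k (cell M z.1) (cells M v)
    & extremal Rad ell p M k z v]%:R * (one_body z v * Lsq v).

(** The cells named are [k + t - 1] and [k - t], where the move can end. Recording them limits how
    many particles of a configuration can be the one just moved. *)
Definition target z v : R :=
  (excess_at M k s.+1 t.-1 (cells M (z :: v)) &&
   ((cell M z.1 == k + t - 1) || (cell M z.1 + t == k)))%N%:R * (one_body z v * Lsq v).

Lemma source_ge0 z v : 0 <= source z v.
Proof. by rewrite mulr_ge0// mulr_ge0 ?one_body_ge0 ?laughlin_sq_ge0. Qed.

Lemma target_ge0 z v : 0 <= target z v.
Proof. by rewrite mulr_ge0// mulr_ge0 ?one_body_ge0 ?laughlin_sq_ge0. Qed.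

Lemma source_measurable n :
  cfg_measurable n.+1 (fun u => (source (head (0, 0) u) (behead u))%:E).
Proof.
move=> d T [//|x xs] sx /measurable_coords_consP[mx mxs].
apply/measurable_EFinP; apply: measurable_funM; last first.
  by apply: measurable_funM; [exact: measurable_one_body|exact: measurable_laughlin_sq].
apply: measurable_natr; apply: measurable_and.
  apply: (measurable_cells Rad0 ell0 p0 M (excess_at M k s t) (xs := x :: xs)).
  exact: measurable_coords_cons.
apply: measurable_and; last exact: measurable_extremal.
apply: (measurable_cells Rad0 ell0 p0 M
  (fun cs => pivot_side k (head 0%N cs) (behead cs)) (xs := x :: xs)).
exact: measurable_coords_cons.
Qed.

Lemma target_measurable n :
  cfg_measurable n.+1 (fun u => (target (head (0, 0) u) (behead u))%:E).
Proof.
move=> d T [//|x xs] sx /measurable_coords_consP[mx mxs].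
apply/measurable_EFinP; apply: measurable_funM; last first.
  by apply: measurable_funM; [exact: measurable_one_body|exact: measurable_laughlin_sq].
apply: measurable_natr.
apply: (measurable_cells Rad0 ell0 p0 M (fun cs => excess_at M k s.+1 t.-1 cs &&
   ((head 0 cs == k + t - 1) || (head 0 cs + t == k)))%N (xs := x :: xs)).
exact: measurable_coords_cons.
Qed.

(** [1 / normal_peak ell] is the Gaussian integral over the old abscissa, [a / 2] the length of the
    window of new abscissas. *)
Definition exchange_factor : R :=
  expR (exchange_exponent Rad ell p s t) / normal_peak ell * (2 / a).

Lemma exchange_factor_gt0 : 0 < exchange_factor.
Proof.
have a0 : 0 < a by exact: spacing_gt0.
have ell0' : ell != 0 by rewrite gt_eqF.
by apply: mulr_gt0; apply: divr_gt0 => //; [exact: expR_gt0|exact: normal_peak_gt0].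
Qed.

Lemma zint_exchange v : size v = M ->
  (zint Rad (fun z => (source z v)%:E) <=
   exchange_factor%:E * zint Rad (fun z => (target z v)%:E))%E.
Proof.
move=> sv.
have a0 : 0 < a by exact: spacing_gt0.
have ell0' : ell != 0 by rewrite gt_eqF.
have pk0 := normal_peak_gt0 ell0'.
have ms : measurable_fun setT (fun z : Z => (source z v)%:E).
  exact: (cfg_measurable_section (@source_measurable M) sv).
have mt : measurable_fun setT (fun z : Z => (target z v)%:E).
  exact: (cfg_measurable_section (@target_measurable M) sv).
set X := zint Rad _.
(* If the source vanishes identically the left side is 0. Otherwise one witness [z0] yields facts
   about [v] alone, valid for the whole window. *)
have [[z0 z0s]|nz] := pselect (exists z, source z v != 0); last first.
  have -> : X = 0%E.
    rewrite /X (eq_zint _ (h := fun=> 0%E)).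
      by rewrite /zint; under eq_integral do rewrite integral0; rewrite integral0.
    move=> z; congr EFin; apply/eqP/negPn/negP => sz.
    by apply: nz; exists z.
  rewrite mule_ge0//; first by rewrite lee_fin ltW ?exchange_factor_gt0.
  by apply: zint_ge0 => z; rewrite lee_fin target_ge0.
have srcP z : source z v != 0 -> [/\ excess_at M k s t (cells M (z :: v)),
    pivot_side k (cell M z.1) (cells M v) & extremal Rad ell p M k z v].
  by rewrite /source; case: and3P => // _; rewrite mul0r eqxx.
have [ex0 pv0 _] := srcP _ z0s.
pose L := below k (cells M v); pose c : R := L%:R * a.
have LM : (L <= M)%N by rewrite -sv -(size_map (fun w => cell M w.1)) below_size.
have [ext side] := excess_at_move t0 ex0 pv0.
(* Cell [L] extends at least [a / 2] to either side of [c = L a], so the window of half-width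
   [a / 4] stays inside it. *)
have tgtE x' y' : `|x' - c| <= a / 4 -> target (x', y') v = one_body (x', y') v * Lsq v.
  move=> xc.
  have cL : cell M x' = L.
    move: xc; rewrite ler_norml => /andP[h1 h2].
    apply: cell_unique => // _; rewrite siteE /c in h1 h2 *.
      by rewrite mulrBl; lra.
    by rewrite -natr1 mulrBl mulrDl; lra.
  rewrite /target /= cL ext /=.
  rewrite (_ : (L == k + t - 1)%N || (L + t == k)%N) ?mul1r//.
  by case/orP: side => /andP[_ ->]; rewrite ?orbT.
pose eG := expR (exchange_exponent Rad ell p s t) / normal_peak ell.
have eG0 : 0 < eG by rewrite divr_gt0// expR_gt0.
pose Y (x' : RM) := (\int[mu]_(y in angles Rad) (target (x', y) v)%:E)%E.
have XY x' : `|x' - c| <= a / 4 -> (X <= eG%:E * Y x')%E.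
  move=> xc.
  pose K := expR (exchange_exponent Rad ell p s t) * one_body_max Rad ell p x' v * Lsq v.
  have K0 : 0 <= K by apply: mulr_ge0; [apply: mulr_ge0; [exact: expR_ge0|exact: one_body_max_ge0]|exact: laughlin_sq_ge0].
  apply: (@le_trans _ _ (zint Rad (fun z => (K * normal_fun c ell z.1)%:E))).
    apply: le_zint => //.
    - apply/measurable_EFinP; apply: measurable_funM; first exact: measurable_cst.
      apply: measurableT_comp; first exact: measurable_normal_fun.
      exact: measurable_fst.
    - by move=> z; rewrite lee_fin source_ge0.
    move=> [x y]; rewrite lee_fin.
    have [->|/[dup] sz /srcP[ex pv extr]] := eqVneq (source (x, y) v) 0.
      by rewrite mulr_ge0// normal_fun_ge0.
    rewrite /source ex pv extr mul1r /= /K [leRHS]mulrAC.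
    apply: ler_wpM2r; first exact: laughlin_sq_ge0.
    rewrite [leRHS]mulrAC.
    exact: (one_body_pivot_le Rad0 ell0 p0 (c := c) erefl kM t0 sv ex pv extr).
  rewrite zint_normal//.
  (* The factor [per] from integrating the old angle is matched by the [per] that Landau's
     inequality supplies for the new one. *)
  have -> : (K * per / normal_peak ell)%:E =
      (eG%:E * ((per * one_body_max Rad ell p x' v * Lsq v)%:E))%E.
    by rewrite -EFinM /K /eG; congr EFin; field; rewrite gt_eqF.
  rewrite lee_pmul2l//.
  pose F (y : RM) := \prod_(w <- v) sqmod_diff Rad (x', y) w ^+ p.
  have mF : measurable_fun (angles Rad) (fun y => (F y)%:E).
    have [A [B [[cA cB _] FE]]] := prod_sqmod_diff_analytic Rad0 p x' v.
    apply/measurable_EFinP/measurable_funTS; rewrite /F (funext FE).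
    apply: measurable_funM; first exact: measurable_cst.
    by apply: measurable_funD; apply: measurable_funX; exact: continuous_measurable_fun.
  have -> : Y x' = ((expR (- (x' ^+ 2 / ell ^+ 2)) * Lsq v)%:E *
      \int[mu]_(y in angles Rad) (F y)%:E)%E.
    rewrite -(ge0_integralZl _ (measurable_angles Rad) mF).
    - apply: eq_integral => y _; rewrite tgtE// -EFinM; congr EFin.
      by rewrite /one_body /F /=; ring.
    - by move=> y _; rewrite lee_fin; apply: prodr_ge0 => w _; rewrite exprn_ge0// sqmod_diff_ge0.
    - by rewrite lee_fin mulr_ge0 ?expR_ge0 ?laughlin_sq_ge0.
  rewrite (_ : per * _ * _ = (expR (- (x' ^+ 2 / ell ^+ 2)) * Lsq v) *
      (per * \prod_(w <- v) maxexp Rad x' w ^+ (2 * p))); last by rewrite /one_body_max; ring.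
  rewrite EFinM; apply: lee_wpmul2l; last exact: integral_prod_sqmod_ge.
  by rewrite lee_fin mulr_ge0 ?expR_ge0 ?laughlin_sq_ge0.
have mY : measurable_fun setT Y.
  apply: (@measurable_integral_param _ _ RM RM R mu _ (fun w => (target w v)%:E)) => //.
    exact: measurable_angles.
  by move=> w; rewrite lee_fin target_ge0.
have Y0 x : (0 <= Y x)%E by apply: integral_ge0 => y _; rewrite lee_fin target_ge0.
have X0 : (0 <= X)%E by apply: zint_ge0 => z; rewrite lee_fin source_ge0.
pose W : set RM := `[c - a / 4, c + a / 4]%classic.
have mW : measurable W by exact: measurable_itv.
have muW : mu W = (a / 2)%:E.
  rewrite lebesgue_measure_itv /= lte_fin ifT; last by lra.
  by rewrite -EFinD; congr EFin; lra.
have XW : ((a / 2)%:E * X <= eG%:E * zint Rad (fun z => (target z v)%:E))%E.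
  rewrite -muW muleC -(integral_cst mu mW).
  apply: (@le_trans _ _ (\int[mu]_(x in W) (eG%:E * Y x))%E).
    apply: ge0_le_integral => //.
    - by apply: measurable_funTS; apply: measurable_funeM.
    - move=> x; rewrite /W /= in_itv /= => /andP[h1 h2]; apply: XY.
      by rewrite ler_norml; apply/andP; split; lra.
  rewrite ge0_integralZl//; [|exact: measurable_funTS|by rewrite lee_fin ltW].
  apply: lee_wpmul2l; first by rewrite lee_fin ltW.
  exact: (ge0_subset_integral mu mW measurableT mY (fun x _ => Y0 x) (@subsetT _ _)).
rewrite /exchange_factor -/eG mulrC EFinM -muleA (_ : 2 / a = (a / 2)^-1); last by rewrite [RHS]invf_div.
by rewrite lee_pdivlMl// divr_gt0.
Qed.

End OneStep.
End Exchange.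

(** * From one distinguished particle to symmetric configurations *)

Section Tail.
Variables (R : realType) (Rad ell : R) (p : nat).
Hypotheses (Rad0 : 0 < Rad) (ell0 : 0 < ell) (p0 : (0 < p)%N).
Local Notation RM := (measurableTypeR R).
Local Notation Z := (RM * RM)%type.
Local Notation cell := (cell Rad ell p).
Local Notation cells := (cells Rad ell p).
Local Notation Lsq := (laughlin_sq Rad ell p).
Local Notation a := (spacing Rad ell p).
Implicit Types (z w : R * R) (u v : seq (R * R)) (M k s t n : nat).

Lemma perm_excess_at M k s t cs cs' : perm_eq cs cs' ->
  excess_at M k s t cs = excess_at M k s t cs'.
Proof.
move=> /permP pcs; rewrite /excess_at /below pcs; congr (_ && _).
by apply: eq_all => i; rewrite pcs.
Qed.

Lemma perm_cells_rem_at M j u : (j < size u)%N ->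
  perm_eq (cells M u) (cells M (nth (0, 0) u j :: rem_at j u)).
Proof. by move=> ju; apply: perm_map; exact: perm_rem_at. Qed.

Lemma mem_rem_at j u : {subset rem_at j u <= u}.
Proof. by move=> w; rewrite mem_cat => /orP[/mem_take|/mem_drop]. Qed.

(** For a positive excess, the rightmost particle left of site [k]; for a negative one, the leftmost
    on the right, which exists because fewer than [k < M.+1] particles are on the left. *)
Lemma pivot_exists M k s t u : size u = M.+1 -> (0 < k <= M)%N -> (0 < t)%N ->
  excess_at M k s t (cells M u) ->
  exists2 j : 'I_(size u), pivot_side k (cell M (nth (0, 0) u j).1) (cells M (rem_at j u))
    & extremal Rad ell p M k (nth (0, 0) u j) (rem_at j u).
Proof.
move=> su kM t0 /excess_atP[ht _].
have belowE (j : 'I_(size u)) :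
    below k (cell M (nth (0, 0) u j).1 :: cells M (rem_at j u)) = below k (cells M u).
  by rewrite /below; apply/esym/permP; exact: perm_cells_rem_at.
pose X (i : 'I_(size u)) : R * R := nth (0, 0) u i.
have cntP (P : pred nat) : (0 < count P (cells M u))%N ->
    exists i : 'I_(size u), P (cell M (X i).1).
  rewrite -has_count => /hasP[c /mapP[w /(nthP (0, 0))[i iu <-] ->] Pc].
  by exists (Ordinal iu).
have [bk|bk] := ltnP k (below k (cells M u)).
  have [i0 Pi0] := cntP (fun c => c < k)%N (leq_ltn_trans (leq0n _) bk).
  have := @arg_maxP _ _ _ i0 (fun i => cell M (X i).1 < k)%N (fun i => (X i).1) Pi0.
  case=> j Pj jmax; exists j; first by rewrite /pivot_side belowE Pj bk.
  apply/allP => w /mem_rem_at /(nthP (0, 0))[i iu <-]; rewrite Pj; apply/implyP => Pi.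
  exact: (jmax (Ordinal iu)).
have {}bk : (below k (cells M u) < k)%N by rewrite /ndist in ht; lia.
have [|i0 Pi0] := cntP (fun c => k <= c)%N.
  have := count_predC (fun c => c < k)%N (cells M u); rewrite size_map su -/(below k _).
  rewrite (eq_count (a2 := fun c => k <= c)%N); last by move=> c /=; rewrite -leqNgt.
  by lia.
have := @arg_minP _ _ _ i0 (fun i => k <= cell M (X i).1)%N (fun i => (X i).1) Pi0.
case=> j Pj jmin; exists j; first by rewrite /pivot_side belowE Pj bk orbT.
apply/allP => w /mem_rem_at /(nthP (0, 0))[i iu <-]; rewrite ltnNge Pj /=; apply/implyP => Pi.
exact: (jmin (Ordinal iu)).
Qed.

Definition excess_weight M k s t u : \bar R := ((excess_at M k s t (cells M u))%:R * Lsq u)%:E.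

Lemma excess_weight_ge0 M k s t u : (0 <= excess_weight M k s t u)%E.
Proof. by rewrite lee_fin mulr_ge0// laughlin_sq_ge0. Qed.

Lemma cells_weight_measurable n M (P : seq nat -> bool) :
  cfg_measurable n (fun u => ((P (cells M u))%:R * Lsq u)%:E).
Proof.
move=> d T xs sx mxs; apply/measurable_EFinP; apply: measurable_funM.
  by apply: measurable_natr; exact: measurable_cells.
exact: measurable_laughlin_sq.
Qed.

Lemma excess_weight_le_sources M k s t u : size u = M.+1 -> (0 < k <= M)%N -> (0 < t)%N ->
  (excess_weight M k s t u <=
   \sum_(j < M.+1) (source Rad ell p M k s t (nth (0, 0) u j) (rem_at j u))%:E)%E.
Proof.
move=> su kM t0; rewrite /excess_weight.
rewrite -(big_mkord xpredT (fun j =>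
  (source Rad ell p M k s t (nth (0, 0) u j) (rem_at j u))%:E)) /index_iota subn0.
have src0 j : (0 <= (source Rad ell p M k s t (nth (0, 0) u j) (rem_at j u))%:E)%E.
  by rewrite lee_fin source_ge0.
case ex : (excess_at M k s t (cells M u)); last by rewrite mul0r; apply: sume_ge0.
have [j pv extr] := pivot_exists su kM t0 ex.
rewrite mul1r (bigD1_seq (j : nat)) ?iota_uniq//=; last first.
  by rewrite (mem_iota 0 M.+1) -su /=.
apply: le_trans (leeDl _ _); last by apply: sume_ge0.
rewrite lee_fin /source pv extr -(perm_excess_at _ _ _ _ (perm_cells_rem_at M (ltn_ord j))) ex.
by rewrite mul1r -laughlin_sq_rem_at.
Qed.

(** Only particles in the cells [k + t - 1] and [k - t] contribute. These cells are within [t] of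
    [k], so [occupation_bound] with [s.+1] allows at most [2 (s + 2 + t)] particles in each. *)
Lemma targets_le_excess_weight M k s t u : size u = M.+1 -> (0 < k <= M)%N -> (0 < t)%N ->
  (\sum_(j < M.+1) (target Rad ell p M k s t (nth (0, 0) u j) (rem_at j u))%:E <=
   (4 * (s + t + 2))%:R%:E * excess_weight M k s.+1 t.-1 u)%E.
Proof.
move=> su kM t0; rewrite /excess_weight.
rewrite -(big_mkord xpredT (fun j =>
  (target Rad ell p M k s t (nth (0, 0) u j) (rem_at j u))%:E)) /index_iota subn0.
pose P c := ((c == k + t - 1) || (c + t == k))%N.
have tgtE j : j \in iota 0 M.+1 ->
    (target Rad ell p M k s t (nth (0, 0) u j) (rem_at j u))%:E =
    ((P (cell M (nth (0, 0) u j).1))%:R *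
     ((excess_at M k s.+1 t.-1 (cells M u))%:R * Lsq u))%:E.
  rewrite mem_iota /= add0n -su => ju.
  rewrite /target -(perm_excess_at _ _ _ _ (perm_cells_rem_at M ju)) -laughlin_sq_rem_at//.
  by congr EFin; rewrite -/(P _); case: (excess_at _ _ _ _ _); case: (P _); rewrite /= ?mul0r ?mul1r.
rewrite big_seq; under eq_bigr => j ju do rewrite tgtE//; rewrite -big_seq.
rewrite sumEFin -mulr_suml -EFinM lee_fin.
case ex : (excess_at M k s.+1 t.-1 (cells M u)); last by rewrite !mul0r !mulr0.
apply: ler_wpM2r; first by rewrite mul1r laughlin_sq_ge0.
rewrite -natr_sum ler_nat.
have -> : (\sum_(j <- iota 0 M.+1) P (cell M (nth (0%R, 0%R) u j).1) = count P (cells M u))%N.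
  rewrite -su -sum1_count big_map [RHS]big_mkcond /= [RHS](big_nth (0, 0)).
  by rewrite /index_iota subn0; apply: eq_bigr => j _; case: (P _).
apply: (@leq_trans (count_mem (k + t - 1)%N (cells M u) + count_mem (k - t)%N (cells M u))).
  rewrite -count_predUI; apply: leq_trans (leq_addr _ _); apply: sub_count => c.
  by rewrite /P /=; lia.
have cb : all (fun c => (c <= M)%N) (cells M u).
  by apply/allP => c /mapP[w _ ->]; exact: cell_max.
have sc : size (cells M u) = M.+1 by rewrite size_map.
have occ c : (count_mem c (cells M u) <= 2 * (s.+1 + 1 + ndist c k))%N.
  have [cM|cM] := leqP c M; first exact: (occupation_bound sc cb kM ex).
  rewrite (_ : count_mem c _ = 0%N)//; apply/eqP; rewrite -leqn0 leqNgt -has_count.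
  by apply/hasPn => c' /(allP cb) /=; lia.
have := occ (k + t - 1)%N; have := occ (k - t)%N.
have : (ndist (k + t - 1) k <= t)%N by rewrite /ndist; lia.
have : (ndist (k - t) k <= t)%N by rewrite /ndist; lia.
clear; move: (count_mem _ _) (count_mem _ _) (ndist _ _) (ndist _ _) => *; lia.
Qed.

End Tail.

(** * Iteration and union bound *)

Section Tail.
Variables (R : realType) (Rad ell : R) (p : nat).
Hypotheses (Rad0 : 0 < Rad) (ell0 : 0 < ell) (p0 : (0 < p)%N).
Local Notation RM := (measurableTypeR R).
Local Notation Z := (RM * RM)%type.
Local Notation cell := (cell Rad ell p).
Local Notation cells := (cells Rad ell p).
Local Notation Lsq := (laughlin_sq Rad ell p).
Local Notation a := (spacing Rad ell p).
Local Notation rate := (rate Rad ell p).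
Local Notation wgt := (wgt Rad ell p).
Local Notation excess_weight := (excess_weight Rad ell p).
Implicit Types (z w : R * R) (u v : seq (R * R)) (M k s t n : nat).

Definition excess_mass M k s t : \bar R := cyl_int Rad M.+1 (excess_weight M k s t).
Definition total_mass M : \bar R := cyl_int Rad M.+1 (fun u => (Lsq u)%:E).

(** The mass is split according to the particle [j] to be moved, each part is treated by
    [zint_exchange] with the integral over that particle innermost, and the targets are summed
    again. *)
Lemma excess_mass_exchange M k s t : (0 < k <= M)%N -> (0 < t)%N ->
  (excess_mass M k s t <=
   (exchange_factor Rad ell p s t * (4 * (s + t + 2))%:R)%:E * excess_mass M k s.+1 t.-1)%E.
Proof.
move=> kM t0; set q := exchange_factor Rad ell p s t.
have q0 : 0 < q by exact: exchange_factor_gt0.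
pose src := fun z v => (source Rad ell p M k s t z v)%:E.
pose tgt := fun z v => (target Rad ell p M k s t z v)%:E.
have src0 z v : (0 <= src z v)%E by rewrite lee_fin source_ge0.
have tgt0 z v : (0 <= tgt z v)%E by rewrite lee_fin target_ge0.
have msrc : cfg_measurable M.+1 (fun u => src (head (0, 0) u) (behead u)).
  exact: source_measurable.
have mtgt : cfg_measurable M.+1 (fun u => tgt (head (0, 0) u) (behead u)).
  exact: target_measurable.
pose srcj j u := src (nth (0, 0) u j) (rem_at j u).
pose tgtj j u := tgt (nth (0, 0) u j) (rem_at j u).
have jM (j : 'I_M.+1) : (j <= M)%N by rewrite -ltnS.
have msrcj (j : 'I_M.+1) : cfg_measurable M.+1 (srcj j).
  exact: (cfg_measurable_rem_at (jM j) msrc).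
have mtgtj (j : 'I_M.+1) : cfg_measurable M.+1 (tgtj j).
  exact: (cfg_measurable_rem_at (jM j) mtgt).
have mew s' t' : cfg_measurable M.+1 (excess_weight M k s' t').
  exact: (cells_weight_measurable Rad0 ell0 p0 (n := M.+1) M (excess_at M k s' t')).
have src_tgt (j : 'I_M.+1) :
    (cyl_int Rad M.+1 (srcj j) <=
     q%:E * cyl_int Rad M.+1 (tgtj j))%E.
  rewrite /srcj /tgtj (cyl_int_insert Rad (jM j) msrc src0) (cyl_int_insert Rad (jM j) mtgt tgt0).
  have zt0 v : (0 <= zint Rad (tgt^~ v))%E by exact: zint_ge0.
  have mzt := cfg_measurable_zint Rad mtgt tgt0.
  rewrite -(cyl_intZ Rad mzt zt0 (ltW q0)).
  apply: le_cyl_int.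
  - exact: (cfg_measurable_zint Rad msrc src0).
  - exact: cfg_measurableZ.
  - by move=> v; exact: zint_ge0.
  - by move=> v; rewrite mule_ge0// lee_fin ltW.
  - by move=> v sv; exact: zint_exchange.
apply: (@le_trans _ _ (cyl_int Rad M.+1
    (fun u => \sum_(j < M.+1) srcj j u))%E).
  apply: le_cyl_int => //.
  - exact: cfg_measurable_sum.
  - by move=> v; exact: excess_weight_ge0.
  - by move=> v; apply: sume_ge0 => j _; exact: src0.
  - by move=> v sv; exact: excess_weight_le_sources.
rewrite cyl_int_sum//; last by move=> j v; exact: src0.
apply: (le_trans (lee_sum _ (fun j _ => src_tgt j))).
rewrite -ge0_sume_distrr; last by move=> j _; apply: cyl_int_ge0 => v; exact: tgt0.
rewrite -cyl_int_sum//; last by move=> j v; exact: tgt0.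
rewrite [(q * _)%:E]EFinM -muleA; apply: lee_wpmul2l; first by rewrite lee_fin ltW.
rewrite /excess_mass -cyl_intZ//; last by move=> v; exact: excess_weight_ge0.
apply: le_cyl_int => //.
- exact: cfg_measurable_sum.
- exact: cfg_measurableZ.
- by move=> v; apply: sume_ge0 => j _; exact: tgt0.
- by move=> v; rewrite mule_ge0 ?excess_weight_ge0// lee_fin.
- by move=> v sv; exact: targets_le_excess_weight.
Qed.

(** Chosen so that [entropy * (s + t + 1)] dominates everything but the gain: [2 * wgt] covers
    [wgt * (s + 2)], the 2 covers [s + t + 2 <= exp(s + t + 2)], and the last term covers the
    constant prefactor. *)
Definition entropy : R :=
  2 * wgt + 2 + (wgt * ell / a) ^+ 2 + rate + 8 / (normal_peak ell * a).

Lemma rate_gt0 : 0 < rate.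
Proof.
have a0 : 0 < a by exact: spacing_gt0.
by apply: divr_gt0; [exact: exprn_gt0|apply: mulr_gt0 => //; exact: exprn_gt0].
Qed.

Lemma wgt_gt0 : 0 < wgt.
Proof. by rewrite mulr_gt0 ?screening_gt0// ltr0n muln_gt0. Qed.

Lemma entropy_gt0 : 0 < entropy.
Proof.
have a0 : 0 < a by exact: spacing_gt0.
have ell0' : ell != 0 by rewrite gt_eqF.
have h1 : 0 < 8 / (normal_peak ell * a) by rewrite divr_gt0// mulr_gt0// normal_peak_gt0.
have := wgt_gt0; have := rate_gt0; have := sqr_ge0 (wgt * ell / a); rewrite /entropy; lra.
Qed.

Lemma exchange_factor_le s t : exchange_factor Rad ell p s t * (4 * (s + t + 2))%:R <=
  expR (entropy * (s + t + 1)%:R - rate * t%:R ^+ 2).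
Proof.
have a0 : 0 < a by exact: spacing_gt0.
have ell0' : ell != 0 by rewrite gt_eqF.
have pk0 := normal_peak_gt0 ell0'.
have w0 := wgt_gt0; have r0 := rate_gt0.
set B := 8 / (normal_peak ell * a).
have B0 : 0 < B by rewrite divr_gt0// mulr_gt0.
have -> : exchange_factor Rad ell p s t * (4 * (s + t + 2))%:R =
   expR (exchange_exponent Rad ell p s t) * (B * (s + t + 2)%:R).
  by rewrite /exchange_factor /B natrM; field; rewrite !gt_eqF.
apply: (@le_trans _ _ (expR (exchange_exponent Rad ell p s t) * (expR B * expR (s + t + 2)%:R))).
  apply: ler_wpM2l; first exact: expR_ge0.
  apply: ler_pM => //; first exact: ltW.
    by apply: le_trans (expR_ge1Dx _); rewrite lerDr.
  by apply: le_trans (expR_ge1Dx _); rewrite lerDr.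
rewrite -!expRD ler_expR /exchange_exponent /entropy -/B.
rewrite !natrD; set Q := (wgt * ell / a) ^+ 2.
have Q0 : 0 <= Q by exact: sqr_ge0.
have s0 : 0 <= s%:R :> R by []; have t0 : 0 <= t%:R :> R by [].
nra.
Qed.

Lemma total_mass_ge0 M : (0 <= total_mass M)%E.
Proof. by apply: cyl_int_ge0 => u; rewrite lee_fin laughlin_sq_ge0. Qed.

(** A move raises [s] and lowers [t], so [s + t + 1] is conserved and all [t] moves have the same
    cost; the gains add up to [rate] times a sum of squares, at least [t^3 / 3]. *)
Lemma excess_mass_iter M k s t : (0 < k <= M)%N ->
  (excess_mass M k s t <=
   (expR (t%:R * (entropy * (s + t + 1)%:R) - rate * (t%:R ^+ 3 / 3)))%:E * total_mass M)%E.
Proof.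
move=> kM; elim: t s => [|t IH] s.
  rewrite mul0r expr0n /= mul0r mulr0 subr0 expR0 mul1e.
  apply: le_cyl_int.
  - exact: (cells_weight_measurable Rad0 ell0 p0 (n := M.+1) M (excess_at M k s 0)).
  - by move=> d T xs sx mxs; apply/measurable_EFinP; exact: measurable_laughlin_sq.
  - by move=> u; exact: excess_weight_ge0.
  - by move=> u; rewrite lee_fin laughlin_sq_ge0.
  - move=> u _; rewrite lee_fin; case: (excess_at _ _ _ _ _); rewrite ?mul1r// mul0r.
    exact: laughlin_sq_ge0.
apply: (le_trans (excess_mass_exchange s kM (ltn0Sn t))).
have F0 : 0 <= exchange_factor Rad ell p s t.+1 * (4 * (s + t.+1 + 2))%:R.
  by rewrite mulr_ge0// ltW// exchange_factor_gt0.
apply: (le_trans (lee_wpmul2l _ (IH s.+1))); first by rewrite lee_fin.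
rewrite muleA -EFinM; apply: lee_wpmul2r; first exact: total_mass_ge0.
rewrite lee_fin.
apply: (le_trans (ler_wpM2r (expR_ge0 _) (exchange_factor_le s t.+1))).
rewrite -expRD ler_expR.
have -> : (s.+1 + t + 1 = s + t.+1 + 1)%N by lia.
have r0 := rate_gt0; set Q := entropy * _.
rewrite -natr1; have t0 : 0 <= t%:R :> R by [].
have : rate * ((t%:R + 1) ^+ 3 / 3) <= rate * ((t%:R + 1) ^+ 2 + t%:R ^+ 3 / 3).
  by apply: ler_wpM2l; [exact: ltW|nra].
rewrite mulrDr; nra.
Qed.

(** Half of the cubic gain [rate / 3]; the other half absorbs the quadratic entropy. *)
Definition tail_rate : R := rate / 6.
(** With [b = 3 * entropy], the cost [b m^2] exceeds [tail_rate m^3] only if [m < b / tail_rate],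
    and is then at most this constant. *)
Definition tail_const : R := 3 * entropy * (3 * entropy / tail_rate) ^+ 2.

Lemma tail_rate_gt0 : 0 < tail_rate.
Proof. by rewrite divr_gt0// rate_gt0. Qed.

Lemma excess_mass_le M k m : (0 < k <= M)%N ->
  (excess_mass M k m m <= (expR (tail_const - tail_rate * m%:R ^+ 3))%:E * total_mass M)%E.
Proof.
move=> kM; apply: (le_trans (excess_mass_iter m m kM)).
apply: lee_wpmul2r; first exact: total_mass_ge0.
rewrite lee_fin ler_expR.
have r0 := tail_rate_gt0; have e0 := entropy_gt0.
have rE : rate = 6 * tail_rate by rewrite /tail_rate; field.
set b := 3 * entropy.
have b0 : 0 < b by rewrite mulr_gt0.
have h1 : m%:R * (entropy * (m + m + 1)%:R) <= b * m%:R ^+ 2.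
  have hm : m%:R * (m + m + 1)%:R <= 3 * m%:R ^+ 2 :> R.
    by rewrite -natrX -!natrM ler_nat; nia.
  have := ler_wpM2l (ltW e0) hm; rewrite /b; move: (m + m + 1)%:R => x; lra.
have h2 : b * m%:R ^+ 2 <= tail_const + tail_rate * m%:R ^+ 3.
  rewrite /tail_const -/b.
  have [mb|mb] := leP (b / tail_rate) m%:R.
    have : b <= tail_rate * m%:R by rewrite mulrC -ler_pdivrMr.
    move/(ler_wpM2r (sqr_ge0 m%:R)) => h.
    have -> : tail_rate * m%:R ^+ 3 = tail_rate * m%:R * m%:R ^+ 2 by ring.
    by apply: (le_trans h); rewrite lerDr mulr_ge0 ?sqr_ge0// ltW.
  apply: (@le_trans _ _ (b * (b / tail_rate) ^+ 2)).
    apply: ler_wpM2l; first exact: ltW.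
    by rewrite lerXn2r ?nnegrE// ltW// divr_gt0.
  by rewrite lerDl mulr_ge0 ?exprn_ge0// ltW.
rewrite rE; lra.
Qed.

(** Splits the cubic exponent so that the sums of the union bound become geometric. *)
Lemma cube_addn (i j : nat) : (i ^ 3 + j <= (i + j) ^ 3)%N.
Proof.
elim: j => [|j IH]; first by rewrite !addn0.
by rewrite !addnS (leq_ltn_trans IH)// ltn_exp2r.
Qed.

(** Union bound over the site [k'] and the surplus [i] of [excess_at_exists]. The double sum factors
    into two geometric ones, bounded by [2 (1 - th)^-2] and [(1 - th)^-2]. *)
Lemma tail_mass_le M k n : (0 < k <= M)%N ->
  (cyl_int Rad M.+1 (fun u => ((n <= ndist (below k (cells M u)) k)%N%:R * Lsq u)%:E) <=
   (2 * expR tail_const * (1 - expR (- tail_rate)) ^- 4 * expR (- (tail_rate * n%:R ^+ 3)))%:E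
   * total_mass M)%E.
Proof.
move=> kM.
pose m k' i := (n + ndist k k' + i)%N.
have mew k' i : cfg_measurable M.+1 (excess_weight M k' (m k' i) (m k' i)).
  exact: (cells_weight_measurable Rad0 ell0 p0 (n := M.+1) M (excess_at M k' (m k' i) (m k' i))).
have ew0 k' i u : (0 <= excess_weight M k' (m k' i) (m k' i) u)%E by exact: excess_weight_ge0.
pose G k' u := (\sum_(i <- iota 0 M.+2) excess_weight M k' (m k' i) (m k' i) u)%E.
have mG k' : cfg_measurable M.+1 (G k') by exact: cfg_measurable_sum.
have G0 k' u : (0 <= G k' u)%E by exact: sume_ge0.
apply: (@le_trans _ _ (cyl_int Rad M.+1 (fun u => \sum_(k' <- iota 1 M) G k' u))%E).
  apply: le_cyl_int.
  - exact: (cells_weight_measurable Rad0 ell0 p0 (n := M.+1) M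
      (fun cs => n <= ndist (below k cs) k)%N).
  - exact: cfg_measurable_sum.
  - by move=> u; rewrite lee_fin mulr_ge0// laughlin_sq_ge0.
  - by move=> u; exact: sume_ge0.
  move=> u su; case: leqP => Hn; last first.
    by rewrite mul0r; exact: sume_ge0.
  have sc : size (cells M u) = M.+1 by rewrite size_map.
  have [k' k'M [i iM ex]] := excess_at_exists sc kM Hn.
  rewrite mul1r (bigD1_seq k') ?iota_uniq//=.
  apply: le_trans (leeDl _ _); last by exact: sume_ge0.
  rewrite /G (bigD1_seq i) ?iota_uniq//=.
  apply: le_trans (leeDl _ _); last by apply: sume_ge0.
  by rewrite /excess_weight ex mul1r.
rewrite (cyl_int_sum Rad (iota 1 M) mG G0).
set th := expR (- tail_rate).
have r0 := tail_rate_gt0.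
have th01 : 0 < th < 1 by rewrite expR_gt0 expR_lt1 oppr_lt0.
pose E0 := expR tail_const * expR (- (tail_rate * n%:R ^+ 3)).
have E00 : 0 <= E0 by rewrite mulr_ge0 ?expR_ge0.
apply: (@le_trans _ _ (\sum_(k' <- iota 1 M) \sum_(i <- iota 0 M.+2)
   ((E0 * (th ^+ ndist k' k * th ^+ i))%:E * total_mass M))%E).
  rewrite big_seq [leRHS]big_seq; apply: lee_sum => k' k'M.
  rewrite (cyl_int_sum Rad (iota 0 M.+2) (mew k') (ew0 k')); apply: lee_sum => i _.
  have k'M' : (0 < k' <= M)%N by move: k'M; rewrite mem_iota; lia.
  apply: (le_trans (excess_mass_le (m k' i) k'M')).
  apply: lee_wpmul2r; first exact: total_mass_ge0.
  rewrite lee_fin /E0 /th -!expRM_natl -!expRD ler_expR.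
  have hm : n%:R ^+ 3 + (ndist k' k)%:R + i%:R <= (m k' i)%:R ^+ 3 :> R.
    rewrite -natrX -natrX -!natrD ler_nat /m (_ : ndist k k' = ndist k' k); last by rewrite /ndist addnC.
    by apply: leq_trans (cube_addn _ _); rewrite leq_add2r; exact: cube_addn.
  have := ler_wpM2l (ltW r0) hm; lra.
have th0 : 0 <= th by exact: expR_ge0.
have x0 k' i : 0 <= E0 * (th ^+ ndist k' k * th ^+ i).
  by rewrite mulr_ge0// mulr_ge0// exprn_ge0.
under eq_bigr => k' _.
  rewrite -ge0_sume_distrl; last by move=> i _; rewrite lee_fin.
  rewrite sumEFin; over.
rewrite -ge0_sume_distrl; last by move=> k' _; rewrite lee_fin sumr_ge0.
rewrite sumEFin; apply: lee_wpmul2r; first exact: total_mass_ge0.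
rewrite lee_fin.
under eq_bigr do rewrite -mulr_sumr -mulr_sumr mulrCA.
rewrite -mulr_suml.
have S1 : \sum_(k' <- iota 1 M) th ^+ ndist k' k <= 2 * (1 - th) ^- 2.
  apply: le_trans (geometric_sum_dist_le th01 M.+1 k).
  rewrite -(big_mkord xpredT (fun i => (1 + (ndist i k)%:R) * th ^+ ndist i k)) /index_iota subn0.
  rewrite [leRHS]big_cons /=; apply: le_trans (_ : _ <= \sum_(i <- iota 1 M) (1 + (ndist i k)%:R) * th ^+ ndist i k) _; last first.
    by rewrite lerDr mulr_ge0 ?exprn_ge0// addr_ge0.
  by apply: ler_sum => i _; rewrite ler_peMl ?exprn_ge0// lerDl.
have S2 : \sum_(i <- iota 0 M.+2) th ^+ i <= (1 - th) ^- 2.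
  apply: le_trans (geometric_sum_le th01 M.+2).
  rewrite -(big_mkord xpredT (fun i => (1 + i%:R) * th ^+ i)) /index_iota subn0.
  by apply: ler_sum => i _; rewrite ler_peMl ?exprn_ge0// lerDl.
have S20 : 0 <= \sum_(i <- iota 0 M.+2) th ^+ i by apply: sumr_ge0 => i _; exact: exprn_ge0.
apply: (@le_trans _ _ ((2 * (1 - th) ^- 2) * (E0 * (1 - th) ^- 2))).
  apply: ler_pM => //.
  - by apply: sumr_ge0 => i _; exact: exprn_ge0.
  - exact: mulr_ge0.
  - exact: ler_wpM2l.
rewrite /E0 le_eqVlt; apply/orP; left; apply/eqP; field.
by case/andP: th01 => _ h; rewrite subr_eq0 gt_eqF.
Qed.

End Tail.

(** * From masses to probabilities *)

Theorem theorem5p4 (R : realType) (Rad ell : R) (p : nat) :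
  0 < Rad -> 0 < ell -> (0 < p)%N ->
  exists C c : R, 0 < C /\ 0 < c /\
    forall N k n : nat, (2 <= N)%N -> (1 <= k <= N.-1)%N ->
      PN Rad ell p N
        (fun z => (n%:Z <= `|Kexcess (xbar Rad ell p k) k z|)%R)
      <= C * expR (- (c * n%:R ^+ 3)).
Proof.
move=> Rad0 ell0 p0.
have r0 := tail_rate_gt0 Rad0 ell0 p0.
exists (2 * expR (tail_const Rad ell p) * (1 - expR (- tail_rate Rad ell p)) ^- 4).
exists (tail_rate Rad ell p).
set C := 2 * _ * _.
have C0 : 0 < C.
  apply: mulr_gt0; first by rewrite mulr_gt0 ?expR_gt0.
  by rewrite invr_gt0 exprn_gt0// subr_gt0 expR_lt1 oppr_lt0.
(* [N = M.+1], so the admissible [k] are exactly the sites 1 to [M] that delimit the cells. *)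
split=> //; split=> // -[//|M] k n _ kM.
have B0 : 0 <= C * expR (- (tail_rate Rad ell p * n%:R ^+ 3)).
  by rewrite mulr_ge0 ?expR_ge0// ltW.
rewrite /PN.
have -> : cyl_int Rad M.+1 (fun z => ((n%:Z <= `|Kexcess (xbar Rad ell p k) k z|)%R%:R *
      laughlin_sq Rad ell p z)%:E) =
    cyl_int Rad M.+1 (fun u => ((n <= ndist (below k (cells Rad ell p M u)) k)%N%:R *
      laughlin_sq Rad ell p u)%:E).
  apply: eq_cyl_int => u _; congr (_%:R * _)%:E.
  have -> : below k (cells Rad ell p M u) = count (fun w : R * R => w.1 <= xbar Rad ell p k) u.
    rewrite /below /cells count_map; apply: eq_count => w /=.
    exact: (cell_ltE Rad0 ell0 p0).
  by rewrite /Kexcess /ndist; lia.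
have := tail_mass_le Rad0 ell0 p0 n kM; rewrite -/C /total_mass.
have num0 : (0 <= cyl_int Rad M.+1 (fun u => ((n <= ndist (below k (cells Rad ell p M u)) k)%N%:R *
      laughlin_sq Rad ell p u)%:E))%E.
  by apply: cyl_int_ge0 => u; rewrite lee_fin mulr_ge0// laughlin_sq_ge0.
have den0 : (0 <= cyl_int Rad M.+1 (fun u => (laughlin_sq Rad ell p u)%:E))%E.
  by apply: cyl_int_ge0 => u; rewrite lee_fin laughlin_sq_ge0.
(* [fine] sends infinite integrals to 0 and division by 0 gives 0; in those cases the quotient is 0
   and [B0] concludes. With both integrals finite and the denominator positive, the mass bound is
   divided through. *)
move: (cyl_int Rad _ _) (cyl_int Rad _ _) num0 den0 => [x| |] // [y| |] // x0 y0 /=;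
  rewrite ?invr0 ?mulr0 ?mul0r//.
rewrite -EFinM lee_fin => xy; move: y0; rewrite lee_fin le_eqVlt => /predU1P[y0|y0].
  by rewrite -y0 invr0 mulr0.
by rewrite ler_pdivrMr.
Qed.
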